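(* Let $n>1$, $\mathcal D=(0,1)^n$, integers $\ell_0\ge2$ and $L>\ell_0$, and constant coefficients $\eta,\rho\in\mathbb R$, $\boldsymbol\beta\in\mathbb R^n$. Let $a(u,v)=\int_{\mathcal D}(\eta\nabla u\cdot\overline{\nabla v}+\boldsymbol\beta\cdot\nabla u\,\bar v+\rho u\bar v)$ and let $\mu_{\mathbf q}=\sup_{\mathbf j\in\mathcal J^{\rm ani}}|a(\widehat\psi^{\rm ani}_{\mathbf j},\widehat\xi_{\mathbf q})|^2$, $\mathbf q\in\mathbb Z^n$, be the local $a$-coherence (see context). Then $$\mu_{\mathbf 0}\lesssim|\rho|^2\,2^{-(2+n)\ell_0},$$ and for all $\mathbf q\ne\mathbf 0$, $$\mu_{\mathbf q}\lesssim\Big(|\eta|^2+\frac{\|\boldsymbol\beta\|_2^2}{\|\mathbf q\|_2^2}+\frac{|\rho|^2}{\|\mathbf q\|_2^4}\Big)2^{-(n-\|\mathbf q\|_0)\ell_0}\min\Big\{\frac{2^{(3\|\mathbf q\|_0-2)L}\|\mathbf q\|_2^2}{|\widehat{\mathbf q}|^{\mathbf 4}},\ \frac{\|\mathbf q\|_2^2}{\|\mathbf q\|_\infty^2|\widehat{\mathbf q}|^{\mathbf 1}}\Big\},$$ where the hidden constants depend exponentially on $n$ (and not on $\mathbf q$, $L$ or the coefficients).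
   Context: 1D functions: $\varphi(x)=\max\{0,1-|x|\}$, $\psi(x)=\sum_{j=-1}^3b_j\varphi(2x-j)$ with $(b_{-1},\dots,b_3)=(\tfrac14,\tfrac12,-\tfrac32,\tfrac12,\tfrac14)$ (biorthogonal B-spline wavelets of order $(2,2)$); $\varphi_{\ell,k}=2^{\ell/2}\varphi(2^\ell\cdot-k)$, $\psi_{\ell,k}=2^{\ell/2}\psi(2^\ell\cdot-k)$, 1-periodized ($f^{\rm per}(x)=\sum_{j\in\mathbb Z}f(x+j)$) on $(0,1)$; convention $\psi_{\ell_0-1,k}:=\varphi_{\ell_0,k}$. Anisotropic wavelets $\psi^{\rm ani}_{\boldsymbol\ell,\mathbf k}(\mathbf x)=\prod_j\psi_{\ell_j,k_j}(x_j)$, indexed by $\mathbf j=(\boldsymbol\ell,\mathbf k)\in\mathcal J^{\rm ani}=\{(\boldsymbol\ell,\mathbf k):\boldsymbol\ell\in\mathbb N^n,\ \ell_0-1\le\boldsymbol\ell<L,\ \mathbf k\in\prod_j\mathbb Z/(2^{\ell_j}\mathbb Z)\}$ (inequalities componentwise), normalized as $\widehat\psi^{\rm ani}_{\mathbf j}=2^{-\|\boldsymbol\ell\|_\infty}\psi^{\rm ani}_{\mathbf j}$. Fourier: $\xi_{\mathbf q}(\mathbf x)=e^{2\pi i\mathbf q\cdot\mathbf x}$, $\widehat\xi_{\mathbf q}=(1+(2\pi\|\mathbf q\|_2)^2)^{-1/2}\xi_{\mathbf q}$. Notation: $\|\mathbf q\|_0$ = number of nonzero entries, $\widehat{\mathbf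 q}=\mathbf q$ restricted to its nonzero entries, $|\mathbf x|^{\mathbf y}=\prod_j|x_j|^{y_j}$, $\mathbf 1=(1,\dots,1)$, $\mathbf 4=(4,\dots,4)$. *)

(* Defs.v *)
From Stdlib Require Import Reals ZArith.
From Coquelicot Require Import Coquelicot.
Open Scope R_scope.

(* Points of R^n are represented as functions nat -> R; only the
   coordinates 0..n-1 are ever read. *)
Definition vec := nat -> R.

Fixpoint rsum (n : nat) (f : nat -> R) : R :=
  match n with O => 0 | S m => rsum m f + f m end.
Fixpoint rprod (n : nat) (f : nat -> R) : R :=
  match n with O => 1 | S m => rprod m f * f m end.
Fixpoint rmax (n : nat) (f : nat -> R) : R :=
  match n with O => 0 | S m => Rmax (rmax m f) (f m) end.
Fixpoint nmax (n : nat) (f : nat -> nat) : nat :=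
  match n with O => O | S m => Nat.max (nmax m f) (f m) end.
Fixpoint csum (n : nat) (f : nat -> C) : C :=
  match n with O => RtoC 0 | S m => Cplus (csum m f) (f m) end.

Definition upd (x : vec) (i : nat) (t : R) : vec :=
  fun j => if Nat.eqb j i then t else x j.

Fixpoint cube_int (n : nat) (f : vec -> R) : R :=
  match n with
  | O => f (fun _ => 0)
  | S m => RInt (fun t => cube_int m (fun x => f (upd x m t))) 0 1
  end.
Definition cint (n : nat) (f : vec -> C) : C :=
  (cube_int n (fun x => Re (f x)), cube_int n (fun x => Im (f x))).

Definition pder (i : nat) (f : vec -> R) (x : vec) : R :=
  Derive (fun t => f (upd x i t)) (x i).
Definition cpder (i : nat) (f : vec -> C) (x : vec) : C :=
  (pder i (fun y => Re (f y)) x, pder i (fun y => Im (f y)) x).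

Definition aform (n : nat) (eta rho : R) (beta : vec) (u : vec -> R) (v : vec -> C) : C :=
  cint n (fun x =>
    Cplus (Cplus
      (Cmult (RtoC eta) (csum n (fun i => Cmult (RtoC (pder i u x)) (Cconj (cpder i v x)))))
      (Cmult (RtoC (rsum n (fun i => beta i * pder i u x))) (Cconj (v x))))
      (Cmult (RtoC (rho * u x)) (Cconj (v x)))).

Definition qnorm2 (n : nat) (q : nat -> Z) : R := sqrt (rsum n (fun i => IZR (q i) ^ 2)).
Definition xi (n : nat) (q : nat -> Z) (x : vec) : C :=
  (cos (2 * PI * rsum n (fun i => IZR (q i) * x i)),
   sin (2 * PI * rsum n (fun i => IZR (q i) * x i))).
Definition xihat (n : nat) (q : nat -> Z) (x : vec) : C :=
  Cmult (RtoC (/ sqrt (1 + (2 * PI * qnorm2 n q) ^ 2))) (xi n q x).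

Definition phi (x : R) : R := Rmax 0 (1 - Rabs x).
Definition psi (x : R) : R :=
  1/4 * phi (2*x + 1) + 1/2 * phi (2*x) - 3/2 * phi (2*x - 1)
  + 1/2 * phi (2*x - 2) + 1/4 * phi (2*x - 3).
(* 1-periodization: sum over j in Z of f(x+j) *)
Definition per (f : R -> R) (x : R) : R :=
  Series (fun j : nat => f (x + INR j) + f (x - INR j - 1)).
Definition phi_lk (l k : nat) (x : R) : R := sqrt (2 ^ l) * phi (2 ^ l * x - INR k).
Definition psi_lk (l k : nat) (x : R) : R := sqrt (2 ^ l) * psi (2 ^ l * x - INR k).
(* convention psi_{l0-1,k} := phi_{l0,k} *)
Definition wav1 (l0 l k : nat) : R -> R :=
  if Nat.eqb l (l0 - 1) then per (phi_lk l0 k) else per (psi_lk l k).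
Definition wav_ani (n l0 : nat) (l k : nat -> nat) (x : vec) : R :=
  rprod n (fun i => wav1 l0 (l i) (k i) (x i)).
Definition wavhat (n l0 : nat) (l k : nat -> nat) (x : vec) : R :=
  / 2 ^ (nmax n l) * wav_ani n l0 l k x.

(* index set J^ani; k_i in Z/2^{l_i}Z represented by 0 <= k_i < 2^{l_i} *)
Definition in_J (n l0 L : nat) (l k : nat -> nat) : Prop :=
  forall i, (i < n)%nat ->
    (l0 - 1 <= l i)%nat /\ (l i < L)%nat /\ (k i < 2 ^ (l i))%nat.

Definition mu (n l0 L : nat) (eta rho : R) (beta : vec) (q : nat -> Z) : Rbar :=
  Lub_Rbar (fun r => exists l k, in_J n l0 L l k /\
     r = (Cmod (aform n eta rho beta (wavhat n l0 l k) (xihat n q))) ^ 2).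

Fixpoint qnorm0 (n : nat) (q : nat -> Z) : nat :=
  match n with O => O | S m => (qnorm0 m q + (if Z.eqb (q m) 0 then 0 else 1))%nat end.
Definition qinf (n : nat) (q : nat -> Z) : R := rmax n (fun i => Rabs (IZR (q i))).
Definition qhatpow (n : nat) (q : nat -> Z) (p : nat) : R :=
  rprod n (fun i => if Z.eqb (q i) 0 then 1 else Rabs (IZR (q i)) ^ p).
Definition vnorm2 (n : nat) (b : vec) : R := sqrt (rsum n (fun i => b i ^ 2)).

(* Main.v *)
Require Import Defs.
From Stdlib Require Import Reals ZArith Lra Lia List FunctionalExtensionality.
From Coquelicot Require Import Coquelicot.
Open Scope R_scope.

(** Integration by parts gives [a(u, xi_q) = (4 pi^2 eta |q|^2 + 2 pi i beta.q + rho) u^(q)],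
and the Fourier coefficient of a tensor product wavelet factorises. In one dimension a wavelet
of scale [N = 2 ^ l] is, on the unit interval, a combination of boundedly many hat functions of
scale [N] with coefficients of size [sqrt N]. Its mass is [O(N^(-1/2))], and two integrations by
parts, the second of which only sees the slope jumps, give
[|w^(q)|^2 <= D min(1 / N, N^3 / q^4)]. Both bounds of the minimum in the theorem, and the bound
at [q = 0], follow from this estimate by spending the normalisation [4 ^ (- max l)] on one coordinate. *)

(** * One-dimensional Fourier coefficients *)

(** For each coordinate i, of scale N_i, the normalisation is at most 4 / N_i^2. Charged to a
    coordinate with q_i nonzero, it turns N^3 / q^4 into 4 N / q^4, which still increases with N;
    hence the exponent 3 |q|_0 - 2 of 2^L. Charged to the largest |q_i|, it turns the interpolated
    bound 1 / |q| into 4 / |q|^3; hence the square of |q|_inf in the denominator. A coordinate with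
    q_i = 0 has only the mass bound, which is worst at the coarsest scale. The formal obstacle is
    that [RInt], [Derive] and [Series] are total functions. Integrals are therefore handled as
    relations that carry existence, a periodized wavelet is replaced by a finite sum equal to it on
    the unit interval, and derivatives are compared off finitely many kinks. *)

Lemma is_RInt_ext_on (f g : R -> R) a b (I : R) : a <= b ->
  (forall x, a < x < b -> f x = g x) -> is_RInt f a b I -> is_RInt g a b I.
Proof.
  intros Hab H. apply is_RInt_ext. rewrite Rmin_left, Rmax_right by lra; auto.
Qed.

Lemma is_RInt_eq (f g : R -> R) a b (I J : R) : (forall x, f x = g x) -> I = J ->
  is_RInt f a b I -> is_RInt g a b J.
Proof. intros H -> HI. apply is_RInt_ext with f; auto. Qed.

Lemma is_RInt_functional (f : R -> R) a b (I J : R) :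
  is_RInt f a b I -> is_RInt f a b J -> I = J.
Proof.
  intros HI HJ.
  rewrite <- (is_RInt_unique (V := R_CompleteNormedModule) f a b I HI).
  exact (is_RInt_unique (V := R_CompleteNormedModule) f a b J HJ).
Qed.

Lemma is_RInt_mult_l (f : R -> R) a b (k I : R) :
  is_RInt f a b I -> is_RInt (fun x => k * f x) a b (k * I).
Proof. apply (is_RInt_scal f a b k I). Qed.

Lemma is_RInt_add (f g : R -> R) a b (I J : R) :
  is_RInt f a b I -> is_RInt g a b J -> is_RInt (fun x => f x + g x) a b (I + J).
Proof. apply (is_RInt_plus f g a b I J). Qed.

Lemma is_RInt_concat (f : R -> R) a b c (I J : R) :
  is_RInt f a b I -> is_RInt f b c J -> is_RInt f a c (I + J).
Proof. apply (is_RInt_Chasles f a b c I J). Qed.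

Lemma is_RInt_primitive (F f : R -> R) a b : (forall x, is_derive F x (f x)) ->
  (forall x, ex_derive f x) -> is_RInt f a b (F b - F a).
Proof.
  intros HF Hf. apply (is_RInt_derive F f); intros x _; auto.
  apply (ex_derive_continuous (V := R_NormedModule)); auto.
Qed.

(** One kink with unit slope jump. Hats are combinations of ramps, so both integration by parts and
    decay need checking for a single kink only. *)
Definition ramp (p x : R) : R := Rmax 0 (x - p).
Definition step (p x : R) : R := if Rlt_dec p x then 1 else 0.

(* [g] is the derivative of [f] off the kinks, and [K] dominates the sum of the slope jumps. The
   last two clauses are the consequences of piecewise linearity that survive linear combination:
   integration by parts against a phase-shifted Fourier mode, and the decay of [g]'s coefficients. *)
Definition pw_linear (f g : R -> R) (K : R) : Prop :=
  (forall x, continuous f x) /\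
  (exists s : list R, forall x, 0 < x < 1 -> ~ In x s -> is_derive f x (g x)) /\
  (forall w th, is_RInt (fun x => g x * cos (w * x + th) - w * (f x * sin (w * x + th)))
     0 1 (f 1 * cos (w + th) - f 0 * cos th)) /\
  (forall w th, exists V : R, is_RInt (fun x => g x * cos (w * x + th)) 0 1 V /\
     Rabs (w * V) <= 2 * K).

(** The phases 0 and pi/2 give the cosine and sine coefficients, so one statement serves both. [J]
    plays the role of an L^1 norm. *)
Definition osc_bound (f : R -> R) (J : R) : Prop :=
  forall w th, exists V : R, is_RInt (fun x => f x * cos (w * x + th)) 0 1 V /\ Rabs V <= J.

(** The two constants scale oppositely for wavelets: [K] like N^(3/2), [J] like N^(-1/2). *)
Definition tame (f : R -> R) (K J : R) : Prop :=
  (exists g, pw_linear f g K) /\ osc_bound f J.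

Lemma pw_linear_scal a f g K :
  pw_linear f g K -> pw_linear (fun x => a * f x) (fun x => a * g x) (Rabs a * K).
Proof.
  intros (H1 & (s & H2) & H3 & H4); repeat split.
  - intros x. apply (continuous_scal_r a f x (H1 x)).
  - exists s; intros x Hx Hs. apply (is_derive_scal f x a (g x)); auto.
  - intros w th. generalize (is_RInt_mult_l _ _ _ a _ (H3 w th)).
    apply is_RInt_eq; intros; ring.
  - intros w th. destruct (H4 w th) as (V & HV & HK). exists (a * V); split.
    + generalize (is_RInt_mult_l _ _ _ a _ HV).
      apply is_RInt_eq; intros; ring.
    + replace (w * (a * V)) with (a * (w * V)) by ring. rewrite Rabs_mult.
      generalize (Rabs_pos a); intros. nra.
Qed.

Lemma pw_linear_plus f1 g1 K1 f2 g2 K2 :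
  pw_linear f1 g1 K1 -> pw_linear f2 g2 K2 ->
  pw_linear (fun x => f1 x + f2 x) (fun x => g1 x + g2 x) (K1 + K2).
Proof.
  intros (A1 & (s & A2) & A3 & A4) (B1 & (s' & B2) & B3 & B4); repeat split.
  - intros x. apply (continuous_plus f1 f2 x (A1 x) (B1 x)).
  - exists (s ++ s')%list; intros x Hx Hs. apply (is_derive_plus f1 f2 x).
    + apply A2; auto; intro; apply Hs, in_or_app; auto.
    + apply B2; auto; intro; apply Hs, in_or_app; auto.
  - intros w th. generalize (is_RInt_add _ _ _ _ _ _ (A3 w th) (B3 w th)).
    apply is_RInt_eq; intros; ring.
  - intros w th. destruct (A4 w th) as (V & HV & HK). destruct (B4 w th) as (V' & HV' & HK').
    exists (V + V'); split.
    + generalize (is_RInt_add _ _ _ _ _ _ HV HV').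
      apply is_RInt_eq; intros; ring.
    + rewrite Rmult_plus_distr_l. eapply Rle_trans; [apply Rabs_triang|]. lra.
Qed.

Lemma osc_bound_scal a f J : osc_bound f J -> osc_bound (fun x => a * f x) (Rabs a * J).
Proof.
  intros H w th. destruct (H w th) as (V & HV & HJ). exists (a * V); split.
  - generalize (is_RInt_mult_l _ _ _ a _ HV).
    apply is_RInt_eq; intros; ring.
  - rewrite Rabs_mult. apply Rmult_le_compat_l; auto using Rabs_pos.
Qed.

Lemma osc_bound_plus f1 J1 f2 J2 :
  osc_bound f1 J1 -> osc_bound f2 J2 -> osc_bound (fun x => f1 x + f2 x) (J1 + J2).
Proof.
  intros A B w th. destruct (A w th) as (V & HV & HJ). destruct (B w th) as (V' & HV' & HJ').
  exists (V + V'); split.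
  - generalize (is_RInt_add _ _ _ _ _ _ HV HV').
    apply is_RInt_eq; intros; ring.
  - eapply Rle_trans; [apply Rabs_triang|]. lra.
Qed.

Lemma tame_scal a f K J : tame f K J -> tame (fun x => a * f x) (Rabs a * K) (Rabs a * J).
Proof.
  intros ((g & H) & H'); split; [eexists; apply pw_linear_scal, H | apply osc_bound_scal, H'].
Qed.

Lemma tame_plus f1 K1 J1 f2 K2 J2 :
  tame f1 K1 J1 -> tame f2 K2 J2 -> tame (fun x => f1 x + f2 x) (K1 + K2) (J1 + J2).
Proof.
  intros ((g & H) & H') ((h & G) & G'); split.
  - eexists; apply pw_linear_plus; eassumption.
  - apply osc_bound_plus; assumption.
Qed.

Lemma continuous_ramp p x : continuous (ramp p) x.
Proof.
  assert (E : ramp p = fun y => / 2 * ((y - p) + Rabs (y - p))).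
  { apply functional_extensionality; intro y; unfold ramp, Rmax, Rabs.
    destruct (Rle_dec 0 (y - p)), (Rcase_abs (y - p)); lra. }
  rewrite E.
  assert (C : continuous (fun y => y - p) x).
  { apply (continuous_minus (fun y => y) (fun _ => p)).
    apply continuous_id. apply continuous_const. }
  apply (continuous_scal_r (/ 2) (fun y => (y - p) + Rabs (y - p))).
  apply (continuous_plus (fun y => y - p) (fun y => Rabs (y - p))); auto.
  apply (continuous_comp (fun y => y - p) Rabs); auto.
  apply continuous_Rabs.
Qed.

Lemma is_derive_ramp p x : x <> p -> is_derive (ramp p) x (step p x).
Proof.
  intros Hx. unfold step. destruct (Rlt_dec p x) as [H|H].
  - apply is_derive_ext_loc with (fun y => y - p).
    + assert (Hd : 0 < x - p) by lra. exists (mkposreal _ Hd). intros y Hy.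
      unfold ball in Hy; simpl in Hy; unfold AbsRing_ball, abs, minus, plus, opp in Hy; simpl in Hy.
      apply Rabs_lt_between in Hy. unfold ramp. rewrite Rmax_right; lra.
    + auto_derive; auto.
  - apply is_derive_ext_loc with (fun y => 0).
    + assert (Hd : 0 < p - x) by lra. exists (mkposreal _ Hd). intros y Hy.
      unfold ball in Hy; simpl in Hy; unfold AbsRing_ball, abs, minus, plus, opp in Hy; simpl in Hy.
      apply Rabs_lt_between in Hy. unfold ramp. rewrite Rmax_left; lra.
    + apply (is_derive_const 0).
Qed.

Lemma is_RInt_zero_on (f : R -> R) a b : a <= b ->
  (forall x, a < x < b -> f x = 0) -> is_RInt f a b 0.
Proof.
  intros Hab H. apply is_RInt_ext_on with (fun _ => 0); auto.
  - intros x Hx; symmetry; auto.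
  - generalize (is_RInt_const (V := R_NormedModule) a b 0).
    unfold scal; simpl; unfold mult; simpl. rewrite Rmult_0_r; auto.
Qed.

Lemma pw_linear_ramp p : pw_linear (ramp p) (step p) 1.
Proof.
  (* [c] is [p] clamped to the unit interval: the ramp is zero before it and x - p after it. The
     last clause rewrites the boundary terms on [0,1] as those of x - p on [c,1], with [y] standing
     for the mode at [c]. *)
  assert (Hc : exists c, 0 <= c <= 1 /\ (forall x, 0 < x < c -> x <= p) /\
    (forall x, c < x < 1 -> p < x) /\
    (forall u v y, (c = 0 -> y = v) -> (c = 1 -> y = u) ->
       ramp p 1 * u - ramp p 0 * v = (1 - p) * u - (c - p) * y)).
  { unfold ramp. destruct (Rle_dec p 0); [|destruct (Rle_dec 1 p)].
    - exists 0; repeat split; try lra; intros; try lra.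
      rewrite !Rmax_right by lra. rewrite H by lra. ring.
    - exists 1; repeat split; try lra; intros; try lra.
      rewrite !Rmax_left by lra. rewrite H0 by lra. ring.
    - exists p; repeat split; try lra; intros; try lra.
      rewrite Rmax_right, Rmax_left by lra. ring. }
  destruct Hc as (c & Hc & Hl & Hr & Hb).
  repeat split.
  - intros; apply continuous_ramp.
  - exists (p :: nil); intros x _ Hs. apply is_derive_ramp.
    intro; apply Hs; simpl; auto.
  - intros w th. rewrite (Hb (cos (w + th)) (cos th) (cos (w * c + th))).
    + rewrite <- (Rplus_0_l (_ - _)). apply (is_RInt_concat _ 0 c 1).
      * apply is_RInt_zero_on; [lra|]. intros x Hx. specialize (Hl x Hx).
        unfold step, ramp. destruct (Rlt_dec p x); [lra|]. rewrite Rmax_left by lra. ring.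
      * apply is_RInt_ext_on with (fun x => cos (w * x + th) - w * ((x - p) * sin (w * x + th)));
          [lra| |].
        { intros x Hx. specialize (Hr x Hx).
          unfold step, ramp. destruct (Rlt_dec p x); [|lra]. rewrite Rmax_right by lra. ring. }
        replace (w + th) with (w * 1 + th) by ring.
        apply (is_RInt_primitive (fun x => (x - p) * cos (w * x + th))).
        { intros x. auto_derive; auto. ring. }
        { intros x. auto_derive; auto. }
    + intros ->; f_equal; ring.
    + intros ->; f_equal; ring.
  - intros w th.
    (* [V] is obtained abstractly because w may be 0; only w * V is computed, as a difference of two
       sines, hence at most 2. *)
    assert (E : ex_RInt (fun x => cos (w * x + th)) c 1).
    { apply (ex_RInt_continuous (V := R_CompleteNormedModule)). intros x _.
      apply (ex_derive_continuous (V := R_NormedModule)). auto_derive; auto. }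
    destruct E as (V & HV). exists V; split.
    + rewrite <- (Rplus_0_l V). apply (is_RInt_concat _ 0 c 1).
      * apply is_RInt_zero_on; [lra|]. intros x Hx. specialize (Hl x Hx).
        unfold step. destruct (Rlt_dec p x); [lra|]. ring.
      * revert HV. apply is_RInt_ext_on; [lra|].
        intros x Hx. specialize (Hr x Hx).
        unfold step. destruct (Rlt_dec p x); [|lra]. ring.
    + assert (HV' : is_RInt (fun x => w * cos (w * x + th)) c 1
                      (sin (w * 1 + th) - sin (w * c + th))).
      { apply (is_RInt_primitive (fun x => sin (w * x + th))).
        { intros x. auto_derive; auto. ring. }
        { intros x. auto_derive; auto. } }
      rewrite (is_RInt_functional _ _ _ _ _ (is_RInt_mult_l _ _ _ w _ HV) HV').
      generalize (SIN_bound (w * 1 + th)) (SIN_bound (w * c + th)); intros.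
      apply Rabs_le; lra.
Qed.

(** A hat is a second difference of ramps. Its slope jumps M, -2M, M account for the constant 4M of
    [pw_linear_phi]. *)
Lemma phi_ramp M b x : 0 < M ->
  phi (M * x - b) = M * ramp ((b - 1) / M) x + (- 2 * M) * ramp (b / M) x + M * ramp ((b + 1) / M) x.
Proof.
  intros HM.
  assert (E : forall p, M * ramp (p / M) x = Rmax 0 (M * x - p)).
  { intro p; unfold ramp. rewrite <- RmaxRmult by lra. f_equal; [ring | field; lra]. }
  rewrite Rmult_assoc, !E. unfold phi, Rmax, Rabs.
  destruct (Rcase_abs (M * x - b)); repeat destruct Rle_dec; lra.
Qed.

Lemma pw_linear_phi M b : 0 < M -> exists g, pw_linear (fun x => phi (M * x - b)) g (4 * M).
Proof.
  intros HM.
  replace (fun x => phi (M * x - b)) with (fun x => M * ramp ((b - 1) / M) x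
    + (- 2 * M) * ramp (b / M) x + M * ramp ((b + 1) / M) x)
    by (apply functional_extensionality; intro; symmetry; apply phi_ramp, HM).
  replace (4 * M) with (Rabs M * 1 + Rabs (- 2 * M) * 1 + Rabs M * 1).
  - eexists. repeat apply pw_linear_plus; apply pw_linear_scal, pw_linear_ramp.
  - rewrite Rabs_mult, !(Rabs_pos_eq M), (Rabs_left (-2)) by lra. ring.
Qed.

(* The integrable majorant [phi y <= 2 / (1 + y^2)] has the primitive [2 * atan]. *)
Lemma osc_bound_phi M b : 0 < M -> osc_bound (fun x => phi (M * x - b)) (8 / M).
Proof.
  intros HM w th.
  destruct (pw_linear_phi M b HM) as (g & Hcont & _).
  assert (E : ex_RInt (fun x => phi (M * x - b) * cos (w * x + th)) 0 1).
  { apply (ex_RInt_continuous (V := R_CompleteNormedModule)). intros x _.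
    apply (continuous_mult (fun x => phi (M * x - b)) (fun x => cos (w * x + th))); auto.
    apply (ex_derive_continuous (V := R_NormedModule)). auto_derive; auto. }
  destruct E as (V & HV). exists V; split; auto.
  (* A majorant integrable on the whole line gives a bound uniform in b, with no case distinction on
     how the support of the hat meets [0,1]. *)
  assert (HI : is_RInt (fun x => 2 / (1 + (M * x - b) ^ 2)) 0 1
            (2 / M * atan (M * 1 - b) - 2 / M * atan (M * 0 - b))).
  { apply (is_RInt_primitive (fun x => 2 / M * atan (M * x - b))).
    { intros x. auto_derive; auto. field. split; [|lra]. generalize (pow2_ge_0 (M * x - b)); lra. }
    { intros x. auto_derive. generalize (pow2_ge_0 (M * x - b)); simpl; lra. } }
  apply Rle_trans with (2 / M * atan (M * 1 - b) - 2 / M * atan (M * 0 - b)).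
  - apply (norm_RInt_le (V := R_NormedModule) (fun x => phi (M * x - b) * cos (w * x + th))
      (fun x => 2 / (1 + (M * x - b) ^ 2)) 0 1 _ _); auto; [lra|].
    intros x _. change (Rabs (phi (M * x - b) * cos (w * x + th)) <= 2 / (1 + (M * x - b) ^ 2)).
    rewrite Rabs_mult. set (y := M * x - b).
    assert (Hphi : 0 <= phi y <= 2 / (1 + y ^ 2)).
    { unfold phi. split; [apply Rmax_l|].
      apply (Rmult_le_reg_r (1 + y ^ 2)); [nra|].
      unfold Rdiv. rewrite Rmult_assoc, Rinv_l by nra.
      unfold Rmax, Rabs; destruct (Rcase_abs y), Rle_dec; nra. }
    rewrite (Rabs_pos_eq (phi y)) by lra.
    assert (Rabs (cos (w * x + th)) <= 1) by (apply Rabs_le; generalize (COS_bound (w * x + th)); lra).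
    generalize (Rabs_pos (cos (w * x + th))). nra.
  (* Two arctangents differ by less than pi, here rounded up to 4; this produces the 8. *)
  - generalize (atan_bound (M * 1 - b)) (atan_bound (M * 0 - b)) PI_4; intros.
    replace (8 / M) with (2 / M * 4) by (field; lra).
    rewrite <- Rmult_minus_distr_l. apply Rmult_le_compat_l; [|lra].
    apply Rlt_le, Rdiv_lt_0_compat; lra.
Qed.

(** * Periodization and one-dimensional wavelets *)

Definition shifts (f : R -> R) (x : R) : R := f x + f (x - 1) + f (x + 1).

Lemma tame_shifts_phi M b : 0 < M -> tame (shifts (fun x => phi (M * x - b))) (12 * M) (24 / M).
Proof.
  intros HM.
  replace (shifts (fun x => phi (M * x - b))) with
    (fun x => phi (M * x - b) + phi (M * x - (b + M)) + phi (M * x - (b - M))).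
  - replace (12 * M) with (4 * M + 4 * M + 4 * M) by ring.
    replace (24 / M) with (8 / M + 8 / M + 8 / M) by (field; lra).
    repeat apply tame_plus; (split; [apply pw_linear_phi, HM | apply osc_bound_phi, HM]).
  - apply functional_extensionality; intro x; unfold shifts.
    replace (M * (x - 1) - b) with (M * x - (b + M)) by ring.
    replace (M * (x + 1) - b) with (M * x - (b - M)) by ring. reflexivity.
Qed.

(** For a function supported in [-1,2], only the translates by -1, 0 and 1 can be nonzero on the
    unit interval. *)
Lemma per_shifts f x : (forall y, y <= -1 \/ 2 <= y -> f y = 0) -> 0 <= x <= 1 ->
  per f x = shifts f x.
Proof.
  intros Hf Hx. unfold per. apply is_series_unique.
  (* The terms of index 0 and 1 contain f x, f (x - 1), f (x + 1) and the vanishing f (x - 2); from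
     index 2 on every argument lies outside the support. *)
  apply (is_series_decr_n _ 2); [lia|].
  match goal with |- is_series _ ?v => replace v with 0 end.
  - apply is_series_ext with (fun _ : nat => 0).
    + intros n. rewrite plus_INR. generalize (pos_INR n); intro. rewrite !Hf; simpl; lra.
    + apply filterlim_ext with (fun _ : nat => 0).
      * intro n. rewrite sum_n_const. ring.
      * apply filterlim_const.
  - simpl. rewrite sum_Sn, sum_O. unfold plus, opp, shifts; simpl.
    rewrite (Hf (x - 1 - 1)) by lra. rewrite Rplus_0_r, Rminus_0_r. ring.
Qed.

(** Equal endpoint values cancel the boundary terms of the first integration by parts at integer
    frequencies. *)
Lemma shifts_periodic f : (forall y, y <= -1 \/ 2 <= y -> f y = 0) -> shifts f 0 = shifts f 1.
Proof.
  intros Hf. unfold shifts. rewrite (Hf (0 - 1)), (Hf (1 + 1)) by lra.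
  replace (1 - 1) with 0 by ring. replace (0 + 1) with 1 by ring. ring.
Qed.

Lemma tame_le f K J K' J' : K <= K' -> J <= J' -> tame f K J -> tame f K' J'.
Proof.
  intros HK HJ ((g & H1 & H2 & H3 & H4) & H); split.
  - exists g; repeat split; auto. intros w th; destruct (H4 w th) as (V & HV & Hle).
    exists V; split; auto; lra.
  - intros w th; destruct (H w th) as (V & HV & Hle). exists V; split; auto; lra.
Qed.

Lemma phi_out x : x <= -1 \/ 1 <= x -> phi x = 0.
Proof.
  intros H. unfold phi. apply Rmax_left. unfold Rabs; destruct (Rcase_abs x); lra.
Qed.

Lemma psi_out x : x <= -1 \/ 2 <= x -> psi x = 0.
Proof. intros H. unfold psi. rewrite !phi_out by lra. ring. Qed.

(** Since k + 1 <= 2 ^ l, the dilated and translated wavelet keeps its support inside [-1,2], as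
    [per_shifts] requires. *)
Lemma dilate_range l k y : (k < 2 ^ l)%nat -> y <= -1 \/ 2 <= y ->
  2 ^ l * y - INR k <= -1 \/ 2 <= 2 ^ l * y - INR k.
Proof.
  intros Hk Hy.
  assert (Hk' : INR k + 1 <= 2 ^ l).
  { rewrite <- S_INR. replace 2 with (INR 2) by reflexivity.
    rewrite <- pow_INR. apply le_INR; lia. }
  generalize (pos_INR k); intro.
  destruct Hy; [left | right]; nra.
Qed.

Lemma sqrt_mul_div c N : 0 < N -> sqrt N * (c / N) = c / sqrt N.
Proof.
  intros HN. assert (Hq := sqrt_lt_R0 N HN).
  replace (c / N) with (c / (sqrt N * sqrt N)) by (rewrite sqrt_sqrt; lra).
  field; lra.
Qed.

(* The dyadic scale at which [wav1 l0 l k] lives; the scaling functions stored at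
   level [l0 - 1] have scale [2 ^ l0]. *)
Definition scale (l0 l : nat) : R := if Nat.eqb l (l0 - 1) then 2 ^ l0 else 2 ^ l.

(** The constants come from psi: the |b_j| sum to 3 and its hats have scale 2N, so the jumps give 3
    times 24 N and the mass 3 times 12 / N. The L^2 normalisation multiplies both by sqrt N. Scaling
    functions obey smaller bounds. *)
Lemma wav1_tame l0 l k : (1 <= l0)%nat -> (l0 - 1 <= l)%nat -> (k < 2 ^ l)%nat ->
  exists F, tame F (72 * (scale l0 l * sqrt (scale l0 l))) (36 / sqrt (scale l0 l)) /\
    (forall x, 0 <= x <= 1 -> wav1 l0 l k x = F x) /\ F 0 = F 1.
Proof.
  intros Hl0 Hl Hk. unfold wav1, scale.
  destruct (Nat.eqb_spec l (l0 - 1)) as [E|E].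
  - assert (Hk' : (k < 2 ^ l0)%nat).
    { apply Nat.lt_le_trans with (1 := Hk). apply Nat.pow_le_mono_r; lia. }
    assert (Hs : forall y, y <= -1 \/ 2 <= y -> phi_lk l0 k y = 0).
    { intros y Hy. unfold phi_lk. rewrite phi_out; [ring|].
      generalize (dilate_range l0 k y Hk' Hy); lra. }
    exists (shifts (phi_lk l0 k)).
    split; [|split; [intros; apply per_shifts; auto | apply shifts_periodic; auto]].
    assert (HN : 0 < 2 ^ l0) by (apply pow_lt; lra). set (N := 2 ^ l0) in *.
    assert (Hq := sqrt_lt_R0 N HN). assert (Hqq := sqrt_sqrt N (Rlt_le _ _ HN)).
    replace (shifts (phi_lk l0 k)) with
      (fun x => sqrt N * shifts (fun y => phi (N * y - INR k)) x)
      by (apply functional_extensionality; intro; unfold shifts, phi_lk; fold N; ring).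
    generalize (tame_scal (sqrt N) _ _ _ (tame_shifts_phi N (INR k) HN)).
    rewrite (Rabs_pos_eq (sqrt N)) by lra. apply tame_le; [nra|].
    rewrite sqrt_mul_div by auto.
    apply Rmult_le_compat_r; [apply Rlt_le, Rinv_0_lt_compat|]; lra.
  - assert (Hs : forall y, y <= -1 \/ 2 <= y -> psi_lk l k y = 0).
    { intros y Hy. unfold psi_lk. rewrite psi_out; [ring|].
      apply dilate_range; auto. }
    exists (shifts (psi_lk l k)).
    split; [|split; [intros; apply per_shifts; auto | apply shifts_periodic; auto]].
    assert (HN : 0 < 2 ^ l) by (apply pow_lt; lra). set (N := 2 ^ l) in *.
    assert (Hq := sqrt_lt_R0 N HN). assert (Hqq := sqrt_sqrt N (Rlt_le _ _ HN)).
    (* The hat phi (2 (N y - k) - j) is rewritten as one dilation by 2N with offset 2k + j. *)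
    pose (h := fun j => shifts (fun y => phi (2 * N * y - (2 * INR k + j)))).
    replace (shifts (psi_lk l k)) with
      (fun x => sqrt N * (1/4 * h (-1) x + 1/2 * h 0 x + (- (3/2)) * h 1 x
                          + 1/2 * h 2 x + 1/4 * h 3 x)).
    + assert (Hh : forall j, tame (h j) (12 * (2 * N)) (24 / (2 * N)))
        by (intro; apply tame_shifts_phi; lra).
      assert (HT := tame_scal (sqrt N) _ _ _
        (tame_plus _ _ _ _ _ _ (tame_plus _ _ _ _ _ _ (tame_plus _ _ _ _ _ _ (tame_plus _ _ _ _ _ _
          (tame_scal (1/4) _ _ _ (Hh (-1))) (tame_scal (1/2) _ _ _ (Hh 0)))
          (tame_scal (- (3/2)) _ _ _ (Hh 1))) (tame_scal (1/2) _ _ _ (Hh 2)))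
          (tame_scal (1/4) _ _ _ (Hh 3)))).
      revert HT. rewrite Rabs_Ropp, !Rabs_pos_eq by lra. apply tame_le; [nra|].
      apply Req_le. rewrite <- sqrt_mul_div by auto. field. lra.
    + apply functional_extensionality; intro x; unfold h, shifts, psi_lk, psi; fold N.
      assert (E1 : forall y, phi (2 * (N * y - INR k) + 1) = phi (2 * N * y - (2 * INR k + -1)))
        by (intro; f_equal; ring).
      assert (E2 : forall y, phi (2 * (N * y - INR k)) = phi (2 * N * y - (2 * INR k + 0)))
        by (intro; f_equal; ring).
      assert (E3 : forall j y, phi (2 * (N * y - INR k) - j) = phi (2 * N * y - (2 * INR k + j)))
        by (intros; f_equal; ring).
      rewrite !E1, !E2, !E3. ring.
Qed.

(** Used to pass from the slope function to [Derive], with which it need not agree at kinks.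
    Splitting at an exceptional point turns it into an endpoint, where values do not matter. *)
Lemma is_RInt_ext_finite (s : list R) (f g : R -> R) : forall a b (I : R), a <= b ->
  (forall x, a < x < b -> ~ In x s -> f x = g x) -> is_RInt f a b I -> is_RInt g a b I.
Proof.
  induction s as [|x0 s IH]; intros a b I Hab H HI.
  - apply is_RInt_ext_on with f; auto.
  - destruct (Rlt_dec a x0); [destruct (Rlt_dec x0 b)|].
    + assert (Hex : ex_RInt f a b) by (exists I; auto).
      destruct (ex_RInt_Chasles_1 f a x0 b (conj (Rlt_le _ _ r) (Rlt_le _ _ r0)) Hex) as (I1 & H1).
      destruct (ex_RInt_Chasles_2 f a x0 b (conj (Rlt_le _ _ r) (Rlt_le _ _ r0)) Hex) as (I2 & H2).
      rewrite (is_RInt_functional f a b I (I1 + I2) HI (is_RInt_concat _ _ _ _ _ _ H1 H2)).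
      apply is_RInt_concat with x0; apply IH; auto; try lra;
        intros x Hx Hs; apply H; [lra| |lra|]; simpl; intros [->|]; auto; lra.
    + apply IH; auto. intros x Hx Hs; apply H; auto. simpl; intros [->|]; auto; lra.
    + apply IH; auto. intros x Hx Hs; apply H; auto. simpl; intros [->|]; auto; lra.
Qed.

Lemma cos_sin_2PI_IZR q : cos (2 * PI * IZR q) = 1 /\ sin (2 * PI * IZR q) = 0.
Proof.
  assert (Hn : forall n, cos (2 * PI * INR n) = 1 /\ sin (2 * PI * INR n) = 0).
  { intro n. replace (2 * PI * INR n) with (0 + 2 * INR n * PI) by ring.
    rewrite cos_period, sin_period, cos_0, sin_0; auto. }
  destruct (Z_le_dec 0 q) as [H|H].
  - replace (IZR q) with (INR (Z.to_nat q)) by (rewrite INR_IZR_INZ, Z2Nat.id; auto). apply Hn.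
  - replace (2 * PI * IZR q) with (- (2 * PI * INR (Z.to_nat (- q)))).
    + rewrite cos_neg, sin_neg. destruct (Hn (Z.to_nat (- q))) as [-> ->]. split; ring.
    + rewrite INR_IZR_INZ, Z2Nat.id, opp_IZR by lia. ring.
Qed.

(** A + iB is the coefficient against exp(-iwx); the clauses on [Derive W] say that differentiation
    multiplies it by iw. *)
Lemma wav1_fourier l0 l k (q : Z) : (1 <= l0)%nat -> (l0 - 1 <= l)%nat -> (k < 2 ^ l)%nat ->
  let W := wav1 l0 l k in let w := 2 * PI * IZR q in
  exists A B : R,
    is_RInt (fun x => W x * cos (w * x)) 0 1 A /\
    is_RInt (fun x => W x * - sin (w * x)) 0 1 B /\
    is_RInt (fun x => Derive W x * cos (w * x)) 0 1 (- w * B) /\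
    is_RInt (fun x => Derive W x * - sin (w * x)) 0 1 (w * A) /\
    A ^ 2 + B ^ 2 <= 2592 / scale l0 l /\
    (A ^ 2 + B ^ 2) * IZR q ^ 4 <= 2592 * scale l0 l ^ 3.
Proof.
  intros Hl0 Hl Hk W w.
  destruct (wav1_tame l0 l k Hl0 Hl Hk) as (F & ((g & Hc & (s & Hd) & HI & HK) & HJ) & HF & Hper).
  fold W in HF.
  assert (HN : 0 < scale l0 l) by (unfold scale; destruct Nat.eqb; apply pow_lt; lra).
  set (N := scale l0 l) in *.
  assert (Hq := sqrt_lt_R0 N HN). assert (Hqq := sqrt_sqrt N (Rlt_le _ _ HN)).
  destruct (cos_sin_2PI_IZR q) as [Hcw Hsw]. fold w in Hcw, Hsw.
  assert (HD : forall x, 0 < x < 1 -> ~ In x s -> g x = Derive W x).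
  { intros x Hx Hs. symmetry. apply is_derive_unique.
    apply is_derive_ext_loc with F; [|auto].
    assert (Hdel : 0 < Rmin x (1 - x)) by (apply Rmin_glb_lt; lra).
    exists (mkposreal _ Hdel). intros y Hy.
    unfold ball in Hy; simpl in Hy; unfold AbsRing_ball, abs, minus, plus, opp in Hy; simpl in Hy.
    apply Rabs_lt_between in Hy. generalize (Rmin_l x (1 - x)) (Rmin_r x (1 - x)); intros.
    symmetry; apply HF; lra. }
  assert (Hsh : forall x, cos (w * x + PI / 2) = - sin (w * x) /\ sin (w * x + PI / 2) = cos (w * x)).
  { intro x. rewrite cos_plus, sin_plus, cos_PI2, sin_PI2. split; ring. }
  destruct (HJ w 0) as (A & HA & HA'). destruct (HJ w (PI / 2)) as (B & HB & HB').
  destruct (HK w 0) as (C1 & HC1 & HC1'). destruct (HK w (PI / 2)) as (C2 & HC2 & HC2').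
  (* Integration by parts at phase 0: the boundary terms cancel because cos w = 1 and F 0 = F 1. For
     [E2], at phase pi/2, each of them vanishes. *)
  assert (E1 : C1 = - w * B).
  { assert (X := is_RInt_add _ _ _ _ _ _ HC1 (is_RInt_mult_l _ _ _ w _ HB)).
    assert (Y : is_RInt (fun x => g x * cos (w * x + 0) + w * (F x * cos (w * x + PI / 2))) 0 1 0).
    { generalize (HI w 0). apply is_RInt_eq.
      - intro x. rewrite (proj1 (Hsh x)), Rplus_0_r. ring.
      - rewrite Rplus_0_r, Hcw, cos_0, Hper. ring. }
    generalize (is_RInt_functional _ _ _ _ _ X Y). lra. }
  assert (E2 : C2 = w * A).
  { assert (X := is_RInt_add _ _ _ _ _ _ HC2 (is_RInt_mult_l _ _ _ (- w) _ HA)).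
    assert (Y : is_RInt (fun x => g x * cos (w * x + PI / 2) + - w * (F x * cos (w * x + 0))) 0 1 0).
    { generalize (HI w (PI / 2)). apply is_RInt_eq.
      - intro x. rewrite (proj2 (Hsh x)), Rplus_0_r. ring.
      - rewrite cos_plus, Hcw, Hsw, cos_PI2, Hper. ring. }
    generalize (is_RInt_functional _ _ _ _ _ X Y). lra. }
  exists A, B. repeat split.
  - revert HA; apply is_RInt_ext_on; [lra|]. intros x Hx. rewrite HF, Rplus_0_r by lra. ring.
  - revert HB; apply is_RInt_ext_on; [lra|]. intros x Hx. rewrite HF, (proj1 (Hsh x)) by lra. ring.
  - rewrite <- E1. revert HC1; apply (is_RInt_ext_finite s); [lra|].
    intros x Hx Hs. rewrite <- HD, Rplus_0_r by auto. ring.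
  - rewrite <- E2. revert HC2; apply (is_RInt_ext_finite s); [lra|].
    intros x Hx Hs. rewrite <- HD, (proj1 (Hsh x)) by auto. ring.
  (* 2592 is twice 36^2, one square for each of A and B. *)
  - assert (X : forall y, Rabs y <= 36 / sqrt N -> y ^ 2 <= 1296 / N).
    { intros y Hy. rewrite <- pow2_abs.
      replace (1296 / N) with ((36 / sqrt N) ^ 2)
        by (rewrite <- (sqrt_mul_div 36 N) by auto; rewrite Rpow_mult_distr, pow2_sqrt by lra;
            field; lra).
      apply pow_incr; split; auto using Rabs_pos. }
    generalize (X A HA') (X B HB'). unfold Rdiv. lra.
  - assert (Hw2 : 36 * IZR q ^ 2 <= w ^ 2).
    { unfold w. generalize PI2_3_2 (pow2_ge_0 (IZR q)); intros.
      replace ((2 * PI * IZR q) ^ 2) with ((2 * PI) ^ 2 * IZR q ^ 2) by ring.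
      apply Rmult_le_compat_r; auto. nra. }
    (* Dividing 144 by the 36 in w^2 >= 36 q^2 leaves 4, whose square 16 is rounded up to 1296 so
       that both estimates share one constant. *)
    assert (X : forall y, Rabs (w * (w * y)) <= 2 * (72 * (N * sqrt N)) ->
                 y ^ 2 * IZR q ^ 4 <= 1296 * N ^ 3).
    { intros y Hy.
      assert (Y : Rabs y * IZR q ^ 2 <= 4 * (N * sqrt N)).
      { rewrite <- Rmult_assoc, Rabs_mult in Hy.
        replace (w * w) with (w ^ 2) in Hy by ring.
        rewrite (Rabs_pos_eq (w ^ 2)) in Hy by apply pow2_ge_0.
        generalize (Rabs_pos y); nra. }
      replace (y ^ 2 * IZR q ^ 4) with ((Rabs y * IZR q ^ 2) ^ 2)
        by (rewrite Rpow_mult_distr, pow2_abs; ring).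
      apply Rle_trans with ((4 * (N * sqrt N)) ^ 2).
      - apply pow_incr; split; auto. apply Rmult_le_pos; [apply Rabs_pos | apply pow2_ge_0].
      - replace ((4 * (N * sqrt N)) ^ 2) with (16 * N ^ 2 * (sqrt N * sqrt N)) by ring.
        rewrite Hqq. assert (0 < N ^ 3) by (apply pow_lt; auto). nra. }
    assert (XA := X A). rewrite <- E2 in XA.
    assert (XB := X B). replace (w * (w * B)) with (- (w * C1)) in XB by (rewrite E1; ring).
    rewrite Rabs_Ropp in XB. specialize (XA HC2'). specialize (XB HC1'). lra.
Qed.

(** * Integration over the cube *)

(** Linearity needs the existence of the iterated integrals, which [cube_int] does not record.
    Asking it of every slice is harmless here: a slice of a tensor product is a constant times a
    lower-dimensional one. *)
Fixpoint is_cube_int (n : nat) (f : vec -> R) (I : R) : Prop :=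
  match n with
  | O => f (fun _ => 0) = I
  | S m => exists g : R -> R,
      (forall t, is_cube_int m (fun x => f (upd x m t)) (g t)) /\ is_RInt g 0 1 I
  end.

Lemma is_cube_int_unique n : forall f I, is_cube_int n f I -> cube_int n f = I.
Proof.
  induction n as [|n IH]; simpl; intros f I H; auto.
  destruct H as (g & Hg & HI).
  replace (fun t => cube_int n (fun x => f (upd x n t))) with g
    by (apply functional_extensionality; intro; symmetry; apply IH, Hg).
  apply (is_RInt_unique (V := R_CompleteNormedModule)), HI.
Qed.

Lemma is_cube_int_plus n : forall f1 f2 I1 I2, is_cube_int n f1 I1 -> is_cube_int n f2 I2 ->
  is_cube_int n (fun x => f1 x + f2 x) (I1 + I2).
Proof.
  induction n as [|n IH]; simpl; intros f1 f2 I1 I2 H1 H2; [lra|].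
  destruct H1 as (g1 & A1 & B1), H2 as (g2 & A2 & B2).
  exists (fun t => g1 t + g2 t); split.
  - intro t. apply (IH (fun x => f1 (upd x n t)) (fun x => f2 (upd x n t))); auto.
  - apply is_RInt_add; auto.
Qed.

Lemma is_cube_int_scal n a : forall f I, is_cube_int n f I ->
  is_cube_int n (fun x => a * f x) (a * I).
Proof.
  induction n as [|n IH]; simpl; intros f I H; [now rewrite H|].
  destruct H as (g & A & B). exists (fun t => a * g t); split.
  - intro t. apply (IH (fun x => f (upd x n t))); auto.
  - apply is_RInt_mult_l; auto.
Qed.

Definition is_RIntC (f : R -> C) (I : C) : Prop :=
  is_RInt (fun t => Re (f t)) 0 1 (Re I) /\ is_RInt (fun t => Im (f t)) 0 1 (Im I).

Definition is_cint (n : nat) (f : vec -> C) (I : C) : Prop :=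
  is_cube_int n (fun x => Re (f x)) (Re I) /\ is_cube_int n (fun x => Im (f x)) (Im I).

Lemma is_cint_unique n f I : is_cint n f I -> cint n f = I.
Proof.
  intros [H1 H2]. unfold cint.
  rewrite (is_cube_int_unique _ _ _ H1), (is_cube_int_unique _ _ _ H2).
  destruct I; reflexivity.
Qed.

Lemma is_cint_ext n f g I J : (forall x, f x = g x) -> I = J -> is_cint n f I -> is_cint n g J.
Proof.
  intros H -> HI. now replace g with f by (apply functional_extensionality, H).
Qed.

Lemma is_cint_plus n f1 f2 I1 I2 : is_cint n f1 I1 -> is_cint n f2 I2 ->
  is_cint n (fun x => Cplus (f1 x) (f2 x)) (Cplus I1 I2).
Proof.
  intros [A1 B1] [A2 B2]; split.
  - exact (is_cube_int_plus n _ _ _ _ A1 A2).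
  - exact (is_cube_int_plus n _ _ _ _ B1 B2).
Qed.

Lemma is_cint_scal n c f I : is_cint n f I -> is_cint n (fun x => Cmult c (f x)) (Cmult c I).
Proof.
  destruct c as [a b]; intros [A B]; split.
  - generalize (is_cube_int_plus n _ _ _ _ (is_cube_int_scal n a _ _ A)
                  (is_cube_int_scal n (- b) _ _ B)).
    replace (fun x => Re (Cmult (a, b) (f x))) with
      (fun x => a * Re (f x) + - b * Im (f x))
      by (apply functional_extensionality; intro; unfold Re, Im; simpl; ring).
    replace (Re (Cmult (a, b) I)) with (a * Re I + - b * Im I)
      by (unfold Re, Im; simpl; ring); auto.
  - generalize (is_cube_int_plus n _ _ _ _ (is_cube_int_scal n a _ _ B)
                  (is_cube_int_scal n b _ _ A)).
    replace (fun x => Im (Cmult (a, b) (f x))) with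
      (fun x => a * Im (f x) + b * Re (f x))
      by (apply functional_extensionality; intro; unfold Re, Im; simpl; ring).
    replace (Im (Cmult (a, b) I)) with (a * Im I + b * Re I)
      by (unfold Re, Im; simpl; ring); auto.
Qed.

Lemma is_cint_zero n : is_cint n (fun _ => RtoC 0) (RtoC 0).
Proof.
  assert (H : is_cube_int n (fun _ => 0) 0).
  { induction n as [|n IH]; simpl; auto. exists (fun _ => 0); split; auto.
    apply is_RInt_zero_on; auto; lra. }
  split; exact H.
Qed.

Lemma is_cint_csum n m (f : nat -> vec -> C) (I : nat -> C) :
  (forall i, (i < m)%nat -> is_cint n (f i) (I i)) ->
  is_cint n (fun x => csum m (fun i => f i x)) (csum m I).
Proof.
  induction m as [|m IH]; intros H; simpl; [apply is_cint_zero|].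
  apply (is_cint_plus n (fun x => csum m (fun i => f i x)) (f m)); auto.
Qed.

Lemma is_RIntC_scal c f I : is_RIntC f I -> is_RIntC (fun x => Cmult c (f x)) (Cmult c I).
Proof.
  destruct c as [a b]; intros [A B]; split.
  - generalize (is_RInt_add _ _ _ _ _ _ (is_RInt_mult_l _ _ _ a _ A)
                  (is_RInt_mult_l _ _ _ (- b) _ B)).
    apply is_RInt_eq; unfold Re, Im; intros; simpl; ring.
  - generalize (is_RInt_add _ _ _ _ _ _ (is_RInt_mult_l _ _ _ a _ B)
                  (is_RInt_mult_l _ _ _ b _ A)).
    apply is_RInt_eq; unfold Re, Im; intros; simpl; ring.
Qed.

Fixpoint cprod (n : nat) (f : nat -> C) : C :=
  match n with O => RtoC 1 | S m => Cmult (cprod m f) (f m) end.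

Lemma cprod_ext n f g : (forall i, (i < n)%nat -> f i = g i) -> cprod n f = cprod n g.
Proof.
  induction n as [|n IH]; intros H; simpl; auto. rewrite IH, H by auto; reflexivity.
Qed.

Lemma cprod_mult n f g : cprod n (fun i => Cmult (f i) (g i)) = Cmult (cprod n f) (cprod n g).
Proof. induction n as [|n IH]; simpl; [|rewrite IH]; ring. Qed.

Lemma cprod_RtoC n f : cprod n (fun i => RtoC (f i)) = RtoC (rprod n f).
Proof. induction n as [|n IH]; simpl; auto. now rewrite IH, RtoC_mult. Qed.

Lemma cprod_update n i c f g : (i < n)%nat -> g i = Cmult c (f i) ->
  (forall j, (j < n)%nat -> j <> i -> g j = f j) -> cprod n g = Cmult c (cprod n f).
Proof.
  induction n as [|n IH]; intros Hi Hc Hg; [lia|]. simpl.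
  destruct (Nat.eq_dec i n) as [->|Hne].
  - rewrite (cprod_ext n g f), Hc by (intros; apply Hg; lia). ring.
  - rewrite IH, Hg by (auto; lia). ring.
Qed.

(** Freezing the last variable leaves a complex constant times a product already integrated by
    induction. The induction runs over complex values because multiplying by that constant mixes
    real and imaginary parts. *)
Lemma is_cint_cprod n (g : nat -> R -> C) (G : nat -> C) :
  (forall i, (i < n)%nat -> is_RIntC (g i) (G i)) ->
  is_cint n (fun x => cprod n (fun i => g i (x i))) (cprod n G).
Proof.
  induction n as [|n IH]; intros H; [split; reflexivity|].
  specialize (IH (fun i Hi => H i (Nat.lt_lt_succ_r _ _ Hi))).
  assert (Hslice : forall t, is_cint n (fun x => cprod (S n) (fun i => g i (upd x n t i)))
                     (Cmult (cprod n G) (g n t))).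
  { intro t. generalize (is_cint_scal n (g n t) _ _ IH). apply is_cint_ext; [|ring].
    intro x. simpl. rewrite Cmult_comm. f_equal.
    - apply cprod_ext; intros i Hi. unfold upd.
      destruct (Nat.eqb_spec i n); [lia | reflexivity].
    - unfold upd. now rewrite Nat.eqb_refl. }
  assert (Hn := is_RIntC_scal (cprod n G) (g n) (G n) (H n (Nat.lt_succ_diag_r n))).
  split.
  - exists (fun t => Re (Cmult (cprod n G) (g n t))); split; [apply Hslice | apply Hn].
  - exists (fun t => Im (Cmult (cprod n G) (g n t))); split; [apply Hslice | apply Hn].
Qed.

(** * The form on tensor products *)

Lemma rprod_ext n f g : (forall i, (i < n)%nat -> f i = g i) -> rprod n f = rprod n g.
Proof.
  induction n as [|n IH]; intros H; simpl; auto. rewrite IH, H by auto; reflexivity.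
Qed.

Lemma rsum_ext n f g : (forall i, (i < n)%nat -> f i = g i) -> rsum n f = rsum n g.
Proof.
  induction n as [|n IH]; intros H; simpl; auto. rewrite IH, H by auto; reflexivity.
Qed.

Lemma rprod_update n i c f g : (i < n)%nat -> g i = c * f i ->
  (forall j, (j < n)%nat -> j <> i -> g j = f j) -> rprod n g = c * rprod n f.
Proof.
  induction n as [|n IH]; intros Hi Hc Hg; [lia|]. simpl.
  destruct (Nat.eq_dec i n) as [->|Hne].
  - rewrite (rprod_ext n g f), Hc by (intros; apply Hg; lia). ring.
  - rewrite IH, Hg by (auto; lia). ring.
Qed.

Lemma rsum_update n i c f g : (i < n)%nat -> g i = c + f i ->
  (forall j, (j < n)%nat -> j <> i -> g j = f j) -> rsum n g = c + rsum n f.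
Proof.
  induction n as [|n IH]; intros Hi Hc Hg; [lia|]. simpl.
  destruct (Nat.eq_dec i n) as [->|Hne].
  - rewrite (rsum_ext n g f), Hc by (intros; apply Hg; lia). ring.
  - rewrite IH, Hg by (auto; lia). ring.
Qed.

(** Along coordinate i the tensor is a constant times [W i], and [Derive] commutes with constants at
    every point, so the identity holds at kinks as well. *)
Lemma pder_tensor n i a (W : nat -> R -> R) x : (i < n)%nat ->
  pder i (fun y => a * rprod n (fun j => W j (y j))) x
  = a * rprod n (fun j => if Nat.eqb j i then Derive (W j) (x j) else W j (x j)).
Proof.
  intros Hi. unfold pder.
  pose (r := rprod n (fun j => if Nat.eqb j i then 1 else W j (x j))).
  replace (fun t => a * rprod n (fun j => W j (upd x i t j))) with (fun t => (a * r) * W i t).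
  - rewrite Derive_scal.
    rewrite (rprod_update n i (Derive (W i) (x i)) (fun j => if Nat.eqb j i then 1 else W j (x j))
      (fun j => if Nat.eqb j i then Derive (W j) (x j) else W j (x j))); auto.
    + fold r. ring.
    + rewrite Nat.eqb_refl. ring.
    + intros j _ Hj. apply Nat.eqb_neq in Hj. now rewrite Hj.
  - apply functional_extensionality; intro t.
    rewrite (rprod_update n i (W i t) (fun j => if Nat.eqb j i then 1 else W j (x j))
      (fun j => W j (upd x i t j))); auto.
    + fold r. ring.
    + unfold upd. rewrite Nat.eqb_refl. ring.
    + intros j _ Hj. unfold upd. apply Nat.eqb_neq in Hj. now rewrite Hj.
Qed.

Definition freq (q : nat -> Z) (i : nat) : R := 2 * PI * IZR (q i).

(** This is exp(-iwt), already conjugated because the form conjugates its second argument. *)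
Definition wave (w t : R) : C := (cos (w * t), - sin (w * t)).

Lemma Cconj_xi n q x : Cconj (xi n q x) = cprod n (fun j => wave (freq q j) (x j)).
Proof.
  unfold xi. induction n as [|n IH]; simpl.
  - rewrite Rmult_0_r, cos_0, sin_0. unfold Cconj, RtoC; simpl. f_equal; ring.
  - rewrite <- IH. unfold Cconj, Cmult, wave, freq; simpl.
    rewrite Rmult_plus_distr_l, cos_plus, sin_plus, <- Rmult_assoc. f_equal; ring.
Qed.

Lemma Cconj_cpder_xihat n q i x : (i < n)%nat ->
  Cconj (cpder i (xihat n q) x)
  = Cmult (Cmult (RtoC (/ sqrt (1 + (2 * PI * qnorm2 n q) ^ 2))) (0, - freq q i))
      (Cconj (xi n q x)).
Proof.
  intros Hi. set (s := / sqrt (1 + (2 * PI * qnorm2 n q) ^ 2)).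
  pose (r := rsum n (fun j => if Nat.eqb j i then 0 else IZR (q j) * x j)).
  assert (E : forall t, rsum n (fun j => IZR (q j) * upd x i t j) = IZR (q i) * t + r).
  { intro t. apply (rsum_update n i); auto.
    - unfold upd. rewrite Nat.eqb_refl. ring.
    - intros j _ Hj. unfold upd. apply Nat.eqb_neq in Hj. now rewrite Hj. }
  assert (E' : rsum n (fun j => IZR (q j) * x j) = IZR (q i) * x i + r).
  { rewrite <- E. apply rsum_ext; intros j _. unfold upd.
    destruct (Nat.eqb_spec j i) as [->|]; reflexivity. }
  assert (D1 : Derive (fun t => Re (xihat n q (upd x i t))) (x i)
               = - s * freq q i * sin (2 * PI * (IZR (q i) * x i + r))).
  { apply is_derive_unique.
    apply (is_derive_ext (fun t => s * cos (2 * PI * (IZR (q i) * t + r)))).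
    - intro t. unfold xihat, xi, Re; fold s; simpl. rewrite E. ring.
    - unfold freq; auto_derive; auto; ring. }
  assert (D2 : Derive (fun t => Im (xihat n q (upd x i t))) (x i)
               = s * freq q i * cos (2 * PI * (IZR (q i) * x i + r))).
  { apply is_derive_unique.
    apply (is_derive_ext (fun t => s * sin (2 * PI * (IZR (q i) * t + r)))).
    - intro t. unfold xihat, xi, Im; fold s; simpl. rewrite E. ring.
    - unfold freq; auto_derive; auto; ring. }
  unfold cpder, pder. rewrite D1, D2.
  unfold xi. rewrite E'. unfold Cconj, Cmult; simpl. f_equal; ring.
Qed.

Lemma RtoC_rsum_mult n f z : Cmult (RtoC (rsum n f)) z = csum n (fun i => Cmult (RtoC (f i)) z).
Proof.
  induction n as [|n IH]; simpl; [ring|]. rewrite <- IH, RtoC_plus. ring.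
Qed.

Lemma csum_RtoC n f : csum n (fun i => RtoC (f i)) = RtoC (rsum n f).
Proof. induction n as [|n IH]; simpl; auto. now rewrite IH, RtoC_plus. Qed.

Lemma csum_scal_r n f c : csum n (fun i => Cmult (f i) c) = Cmult (csum n f) c.
Proof. induction n as [|n IH]; simpl; [|rewrite IH]; ring. Qed.

(* Integrating by parts against a Fourier mode turns the form into multiplication by its symbol. *)
Lemma aform_tensor n eta rho beta q a (W : nat -> R -> R) (G : nat -> C) :
  (forall i, (i < n)%nat ->
     is_RIntC (fun t => Cmult (RtoC (W i t)) (wave (freq q i) t)) (G i) /\
     is_RIntC (fun t => Cmult (RtoC (Derive (W i) t)) (wave (freq q i) t))
       (Cmult (0, freq q i) (G i))) ->
  aform n eta rho beta (fun x => a * rprod n (fun j => W j (x j))) (xihat n q)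
  = Cmult (RtoC (/ sqrt (1 + (2 * PI * qnorm2 n q) ^ 2) * a))
      (Cmult (eta * rsum n (fun i => freq q i ^ 2) + rho, rsum n (fun i => beta i * freq q i))
         (cprod n G)).
Proof.
  intros HG. set (s := / sqrt (1 + (2 * PI * qnorm2 n q) ^ 2)).
  set (u := fun x : vec => a * rprod n (fun j => W j (x j))).
  assert (Hu : is_cint n (fun x => Cmult (RtoC (u x)) (Cconj (xi n q x)))
                 (Cmult (RtoC a) (cprod n G))).
  { generalize (is_cint_scal n (RtoC a) _ _ (is_cint_cprod n
      (fun i t => Cmult (RtoC (W i t)) (wave (freq q i) t)) G (fun i Hi => proj1 (HG i Hi)))).
    apply is_cint_ext; auto. intro x. rewrite Cconj_xi, cprod_mult, cprod_RtoC.
    unfold u. rewrite RtoC_mult. ring. }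
  assert (Hd : forall i, (i < n)%nat ->
    is_cint n (fun x => Cmult (RtoC (pder i u x)) (Cconj (xi n q x)))
      (Cmult (0, freq q i) (Cmult (RtoC a) (cprod n G)))).
  { intros i Hi.
    (* The tensor product with factor i differentiated; the dependent match picks the integral of
       [Derive (W i)] there and that of [W j] elsewhere. *)
    generalize (is_cint_scal n (RtoC a) _ _ (is_cint_cprod n
      (fun j t => Cmult (RtoC (if Nat.eqb j i then Derive (W j) t else W j t)) (wave (freq q j) t))
      (fun j => if Nat.eqb j i then Cmult (0, freq q j) (G j) else G j)
      (fun j Hj => match Nat.eqb j i as b return
         is_RIntC (fun t => Cmult (RtoC (if b then Derive (W j) t else W j t)) (wave (freq q j) t))
           (if b then Cmult (0, freq q j) (G j) else G j)
         with true => proj2 (HG j Hj) | false => proj1 (HG j Hj) end))).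
    apply is_cint_ext.
    - intro x. unfold u. rewrite Cconj_xi, cprod_mult, cprod_RtoC, pder_tensor by auto.
      rewrite RtoC_mult. ring.
    - rewrite (cprod_update n i (0, freq q i) G); auto; [ring| |].
      + now rewrite Nat.eqb_refl.
      + intros j _ Hj. apply Nat.eqb_neq in Hj. now rewrite Hj. }
  unfold aform. apply is_cint_unique.
  set (P := Cmult (RtoC a) (cprod n G)) in *.
  assert (Hxh : forall x, Cconj (xihat n q x) = Cmult (RtoC s) (Cconj (xi n q x))).
  { intro x. unfold xihat. fold s. unfold Cconj, Cmult; simpl. f_equal; ring. }
  assert (H1 : is_cint n
     (fun x => csum n (fun i => Cmult (RtoC (pder i u x)) (Cconj (cpder i (xihat n q) x))))
     (csum n (fun i => Cmult (RtoC (freq q i ^ 2)) (Cmult (RtoC s) P)))).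
  { apply is_cint_csum. intros i Hi.
    generalize (is_cint_scal n (Cmult (RtoC s) (0, - freq q i)) _ _ (Hd i Hi)).
    apply is_cint_ext.
    - intro x. rewrite Cconj_cpder_xihat by auto. fold s. ring.
    (* The conjugated derivative of the mode contributes -iw and the wavelet's derivative iw; their
       product is the real w^2 of the Laplacian. *)
    - replace (RtoC (freq q i ^ 2)) with (Cmult (0, - freq q i) (0, freq q i)); [ring|].
      unfold Cmult, RtoC; simpl. f_equal; ring. }
  assert (H2 : is_cint n
     (fun x => csum n (fun i => Cmult (RtoC (beta i * pder i u x)) (Cconj (xihat n q x))))
     (csum n (fun i => Cmult (RtoC (beta i * freq q i)) (Cmult (0, 1) (Cmult (RtoC s) P))))).
  { apply is_cint_csum. intros i Hi.
    generalize (is_cint_scal n (RtoC (beta i * s)) _ _ (Hd i Hi)).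
    apply is_cint_ext.
    - intro x. rewrite Hxh, !RtoC_mult. ring.
    - replace (0, freq q i) with (Cmult (RtoC (freq q i)) (0, 1)); [rewrite !RtoC_mult; ring|].
      unfold Cmult, RtoC; simpl. f_equal; ring. }
  generalize (is_cint_plus n _ _ _ _ (is_cint_plus n _ _ _ _
    (is_cint_scal n (RtoC eta) _ _ H1) H2) (is_cint_scal n (RtoC (rho * s)) _ _ Hu)).
  apply is_cint_ext.
  - intro x. rewrite RtoC_rsum_mult. f_equal. rewrite Hxh, !RtoC_mult. ring.
  - rewrite !csum_scal_r, !csum_RtoC. unfold P.
    set (X := rsum n (fun i => freq q i ^ 2)). set (Y := rsum n (fun i => beta i * freq q i)).
    rewrite !RtoC_mult.
    replace (eta * X + rho, Y) with (Cplus (RtoC (eta * X + rho)) (Cmult (0, 1) (RtoC Y))).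
    + rewrite RtoC_plus, !RtoC_mult. ring.
    + unfold Cplus, Cmult, RtoC; simpl. f_equal; ring.
Qed.

(** * Coherence bounds *)

Lemma Cmod_sqr z : Cmod z ^ 2 = fst z ^ 2 + snd z ^ 2.
Proof.
  unfold Cmod. apply pow2_sqrt. generalize (pow2_ge_0 (fst z)) (pow2_ge_0 (snd z)); lra.
Qed.

Lemma Cmod_sqr_mult z1 z2 : Cmod (Cmult z1 z2) ^ 2 = Cmod z1 ^ 2 * Cmod z2 ^ 2.
Proof. rewrite Cmod_mult. ring. Qed.

Lemma Cmod_sqr_cprod n G : Cmod (cprod n G) ^ 2 = rprod n (fun i => Cmod (G i) ^ 2).
Proof.
  induction n as [|n IH]; simpl cprod; simpl rprod.
  - rewrite Cmod_1. ring.
  - now rewrite Cmod_sqr_mult, IH.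
Qed.

(** Squared modulus of the Fourier multiplier of the form, including the normalisation of
    [xihat]. *)
Definition symbol_sqr (n : nat) (eta rho : R) (beta : vec) (q : nat -> Z) : R :=
  / (1 + (2 * PI * qnorm2 n q) ^ 2) *
  ((eta * rsum n (fun i => freq q i ^ 2) + rho) ^ 2 + rsum n (fun i => beta i * freq q i) ^ 2).

(** With [E i] the squared modulus of the i-th one-dimensional coefficient, everything that follows
    concerns products of non-negative reals. *)
Lemma aform_wavhat n l0 L l k eta rho beta q : (2 <= l0)%nat -> in_J n l0 L l k ->
  exists E : nat -> R,
    (forall i, (i < n)%nat -> 0 <= E i <= 2592 / scale l0 (l i) /\
       E i * IZR (q i) ^ 4 <= 2592 * scale l0 (l i) ^ 3) /\
    Cmod (aform n eta rho beta (wavhat n l0 l k) (xihat n q)) ^ 2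
    = symbol_sqr n eta rho beta q * (rprod n E * / 4 ^ nmax n l).
Proof.
  intros Hl0 HJ.
  pose (W := fun i => wav1 l0 (l i) (k i)).
  (* Defined by the total [RInt], so that no choice over i is made; it is identified with the A and
     B of [wav1_fourier] below. *)
  pose (G := fun i => (RInt (fun x => W i x * cos (freq q i * x)) 0 1,
                       RInt (fun x => W i x * - sin (freq q i * x)) 0 1) : C).
  assert (HG : forall i, (i < n)%nat ->
     (is_RIntC (fun t => Cmult (RtoC (W i t)) (wave (freq q i) t)) (G i) /\
      is_RIntC (fun t => Cmult (RtoC (Derive (W i) t)) (wave (freq q i) t))
        (Cmult (0, freq q i) (G i))) /\
     Cmod (G i) ^ 2 <= 2592 / scale l0 (l i) /\
     Cmod (G i) ^ 2 * IZR (q i) ^ 4 <= 2592 * scale l0 (l i) ^ 3).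
  { intros i Hi. destruct (HJ i Hi) as (Hl & _ & Hk).
    destruct (wav1_fourier l0 (l i) (k i) (q i)) as (A & B & HA & HB & HA' & HB' & H1 & H2); auto;
      [lia|].
    fold (W i) in HA, HB, HA', HB'. fold (freq q i) in HA, HB, HA', HB'.
    assert (EG : G i = (A, B)).
    { unfold G. f_equal; apply (is_RInt_unique (V := R_CompleteNormedModule)); auto. }
    rewrite Cmod_sqr, EG; simpl fst; simpl snd. repeat split; auto.
    - revert HA; apply is_RInt_eq; intros; unfold Re, wave; simpl; ring.
    - revert HB; apply is_RInt_eq; intros; unfold Im, wave; simpl; ring.
    - revert HA'; apply is_RInt_eq; intros; unfold Re, wave; simpl; ring.
    - revert HB'; apply is_RInt_eq; intros; unfold Im, wave; simpl; ring. }
  exists (fun i => Cmod (G i) ^ 2); split.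
  - intros i Hi. destruct (HG i Hi) as (_ & H1 & H2). repeat split; auto using pow2_ge_0.
  - change (wavhat n l0 l k) with (fun x : vec => / 2 ^ nmax n l * rprod n (fun j => W j (x j))).
    rewrite (aform_tensor n eta rho beta q _ W G) by (intros i Hi; apply HG; auto).
    rewrite !Cmod_sqr_mult, Cmod_sqr_cprod, !Cmod_sqr. unfold symbol_sqr, RtoC; cbn [fst snd].
    replace (4 ^ nmax n l) with (2 ^ nmax n l * 2 ^ nmax n l)
      by (rewrite <- Rpow_mult_distr; f_equal; ring).
    assert (H : 0 < 1 + (2 * PI * qnorm2 n q) ^ 2)
      by (generalize (pow2_ge_0 (2 * PI * qnorm2 n q)); lra).
    assert (Hs : (/ sqrt (1 + (2 * PI * qnorm2 n q) ^ 2)) ^ 2 = / (1 + (2 * PI * qnorm2 n q) ^ 2)).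
    { rewrite pow_inv, pow2_sqrt; lra. }
    rewrite (Rpow_mult_distr (/ sqrt _)), Hs, pow_inv.
    assert (0 < 2 ^ nmax n l) by (apply pow_lt; lra).
    field. split; lra.
Qed.

(** * Size of the symbol *)

Lemma rsum_sqr_nonneg n f : 0 <= rsum n (fun i => f i ^ 2).
Proof.
  induction n as [|n IH]; cbn [rsum]; [lra|]. generalize (pow2_ge_0 (f n)); lra.
Qed.

Lemma rsum_scal n c f : rsum n (fun i => c * f i) = c * rsum n f.
Proof. induction n as [|n IH]; simpl; [|rewrite IH]; ring. Qed.

Lemma rsum_cauchy_schwarz n a b :
  rsum n (fun i => a i * b i) ^ 2 <= rsum n (fun i => a i ^ 2) * rsum n (fun i => b i ^ 2).
Proof.
  induction n as [|n IH]; cbn [rsum]; [lra|].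
  generalize (rsum_sqr_nonneg n a) (rsum_sqr_nonneg n b).
  set (X := rsum n (fun i => a i * b i)) in *.
  set (A := rsum n (fun i => a i ^ 2)) in *. set (B := rsum n (fun i => b i ^ 2)) in *.
  generalize (a n) (b n); intros u v HA HB.
  (* The cross term is handled by comparing squares: X^2 <= A B, and 4 A B u^2 v^2 <= (A v^2 + B
     u^2)^2. *)
  assert (H : 2 * X * (u * v) <= A * v ^ 2 + B * u ^ 2).
  { assert (Hu := pow2_ge_0 u). assert (Hv := pow2_ge_0 v).
    assert (0 <= A * v ^ 2) by (apply Rmult_le_pos; auto).
    assert (0 <= B * u ^ 2) by (apply Rmult_le_pos; auto).
    apply Rsqr_incr_0_var; [|lra]. unfold Rsqr.
    assert (X ^ 2 * (u ^ 2 * v ^ 2) <= A * B * (u ^ 2 * v ^ 2))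
      by (apply Rmult_le_compat_r; auto; apply Rmult_le_pos; auto).
    generalize (pow2_ge_0 (A * v ^ 2 - B * u ^ 2)). nra. }
  nra.
Qed.

Lemma qnorm2_sqr n q : qnorm2 n q ^ 2 = rsum n (fun i => IZR (q i) ^ 2).
Proof. apply pow2_sqrt, rsum_sqr_nonneg. Qed.

Lemma rsum_freq_sqr n q : rsum n (fun i => freq q i ^ 2) = (2 * PI * qnorm2 n q) ^ 2.
Proof.
  rewrite Rpow_mult_distr, qnorm2_sqr, <- rsum_scal.
  apply rsum_ext; intros; unfold freq; ring.
Qed.

Lemma symbol_sqr_zero n eta rho beta : symbol_sqr n eta rho beta (fun _ => 0%Z) = Rabs rho ^ 2.
Proof.
  unfold symbol_sqr. rewrite rsum_freq_sqr.
  assert (H : qnorm2 n (fun _ => 0%Z) ^ 2 = 0).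
  { rewrite qnorm2_sqr. induction n as [|n IH]; cbn [rsum]; [|rewrite IH]; ring. }
  rewrite Rpow_mult_distr, H.
  rewrite (rsum_ext n _ (fun i => 0 * 0)) by (intros; unfold freq; ring).
  rewrite rsum_scal, pow2_abs, !Rmult_0_r, Rplus_0_r, Rinv_1. ring.
Qed.

(** The squared symbol has order |q|^4 and the normalisation removes |q|^2. The remaining |q|^2
    becomes the numerator in both terms of the minimum. 128 is 2, from squaring a sum, times 64,
    which bounds (2 pi)^2. *)
Lemma symbol_sqr_le n eta rho beta q : 0 < qnorm2 n q ->
  symbol_sqr n eta rho beta q <= 128 * qnorm2 n q ^ 2 *
    (Rabs eta ^ 2 + vnorm2 n beta ^ 2 / qnorm2 n q ^ 2 + Rabs rho ^ 2 / qnorm2 n q ^ 4).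
Proof.
  intros HQ. unfold symbol_sqr. rewrite rsum_freq_sqr.
  assert (HB : rsum n (fun i => beta i * freq q i) ^ 2
               <= vnorm2 n beta ^ 2 * (2 * PI * qnorm2 n q) ^ 2).
  { rewrite <- rsum_freq_sqr. unfold vnorm2. rewrite pow2_sqrt by apply rsum_sqr_nonneg.
    apply rsum_cauchy_schwarz. }
  rewrite !pow2_abs. set (Y := rsum n (fun i => beta i * freq q i)) in *.
  set (Q := qnorm2 n q) in *. set (b := vnorm2 n beta) in *.
  assert (HQ2 : 0 < Q ^ 2) by (apply pow_lt; auto).
  assert (HP : 36 * Q ^ 2 <= (2 * PI * Q) ^ 2 <= 64 * Q ^ 2).
  { rewrite Rpow_mult_distr. generalize PI2_3_2 PI_4; intros.
    split; apply Rmult_le_compat_r; try lra; nra. }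
  set (S := (2 * PI * Q) ^ 2) in *.
  apply (Rmult_le_reg_l (1 + S)); [lra|]. rewrite <- Rmult_assoc, Rinv_r, Rmult_1_l by lra.
  replace (128 * Q ^ 2 * (eta ^ 2 + b ^ 2 / Q ^ 2 + rho ^ 2 / Q ^ 4))
    with (128 * (eta ^ 2 * Q ^ 2 + b ^ 2 + rho ^ 2 / Q ^ 2)) by (field; lra).
  assert (Hr : 0 <= rho ^ 2 / Q ^ 2)
    by (apply Rmult_le_pos; [apply pow2_ge_0 | apply Rlt_le, Rinv_0_lt_compat; auto]).
  assert (Hr' : rho ^ 2 / Q ^ 2 * Q ^ 2 = rho ^ 2) by (field; lra).
  set (z := rho ^ 2 / Q ^ 2) in *. set (P := Q ^ 2) in *.
  assert (He := pow2_ge_0 eta). assert (Hb := pow2_ge_0 b).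
  assert (H1 : (eta * S + rho) ^ 2 <= 2 * (eta ^ 2 * S ^ 2) + 2 * rho ^ 2)
    by (generalize (pow2_ge_0 (eta * S - rho)); nra).
  assert (H2 : eta ^ 2 * S ^ 2 <= 64 * (eta ^ 2 * P * S)).
  { replace (eta ^ 2 * S ^ 2) with (eta ^ 2 * S * S) by ring.
    replace (64 * (eta ^ 2 * P * S)) with (eta ^ 2 * S * (64 * P)) by ring.
    apply Rmult_le_compat_l; [apply Rmult_le_pos|]; lra. }
  assert (H3 : rho ^ 2 <= z * S) by (rewrite <- Hr'; apply Rmult_le_compat_l; lra).
  assert (H4 : 0 <= eta ^ 2 * P) by (apply Rmult_le_pos; lra).
  assert (H5 : 0 <= b ^ 2 * S) by (apply Rmult_le_pos; lra).
  assert (H6 : 0 <= z * S) by (apply Rmult_le_pos; lra).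
  assert (H7 : 0 <= eta ^ 2 * P * S) by (apply Rmult_le_pos; lra).
  nra.
Qed.

(** * Products of coordinatewise bounds *)

Lemma rprod_const n c : rprod n (fun _ => c) = c ^ n.
Proof. induction n as [|n IH]; simpl; [|rewrite IH]; ring. Qed.

Lemma rprod_scal n c f : rprod n (fun i => c * f i) = c ^ n * rprod n f.
Proof. induction n as [|n IH]; simpl; [|rewrite IH]; ring. Qed.

Lemma rprod_nonneg n E : (forall i, (i < n)%nat -> 0 <= E i) -> 0 <= rprod n E.
Proof.
  induction n as [|n IH]; intros H; simpl; [lra|]. apply Rmult_le_pos; auto.
Qed.

Lemma rprod_le n E F : (forall i, (i < n)%nat -> 0 <= E i <= F i) -> rprod n E <= rprod n F.
Proof.
  induction n as [|n IH]; intros H; simpl; [lra|].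
  apply Rmult_le_compat; auto; try apply H; auto.
  apply rprod_nonneg; intros; apply H; auto.
Qed.

(** Charges the extra factor [t], later the normalisation, to coordinate i alone. *)
Lemma rprod_le_at n i E F t t' : (i < n)%nat ->
  (forall j, (j < n)%nat -> 0 <= E j <= F j) -> 0 <= t -> E i * t <= F i * t' ->
  rprod n E * t <= rprod n F * t'.
Proof.
  induction n as [|n IH]; intros Hi H Ht Ht'; [lia|]. simpl.
  assert (0 <= rprod n E) by (apply rprod_nonneg; intros; apply H; auto).
  destruct (Nat.eq_dec i n) as [->|Hne].
  - rewrite !Rmult_assoc. apply Rmult_le_compat; auto.
    + apply Rmult_le_pos; auto. apply H; auto.
    + apply rprod_le; auto.
  - replace (rprod n E * E n * t) with (rprod n E * t * E n) by ring.
    replace (rprod n F * F n * t') with (rprod n F * t' * F n) by ring.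
    apply Rmult_le_compat; try (apply H; lia); [apply Rmult_le_pos; auto|].
    apply IH; auto; lia.
Qed.

Lemma nmax_ge n f i : (i < n)%nat -> (f i <= nmax n f)%nat.
Proof.
  induction n as [|n IH]; intros Hi; [lia|]. simpl.
  destruct (Nat.eq_dec i n) as [->|]; [lia|]. specialize (IH ltac:(lia)); lia.
Qed.

Lemma rmax_ge n f i : (i < n)%nat -> f i <= rmax n f.
Proof.
  induction n as [|n IH]; intros Hi; [lia|]. simpl.
  destruct (Nat.eq_dec i n) as [->|]; [apply Rmax_r|].
  apply Rle_trans with (rmax n f); [apply IH; lia | apply Rmax_l].
Qed.

Lemma rmax_attained n f : 0 < rmax n f -> exists i, (i < n)%nat /\ rmax n f = f i.
Proof.
  induction n as [|n IH]; simpl; [lra|].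
  unfold Rmax; destruct (Rle_dec (rmax n f) (f n)); intros H.
  - exists n; auto.
  - destruct (IH H) as (i & Hi & E). exists i; auto.
Qed.

Lemma qnorm0_le n q : (qnorm0 n q <= n)%nat.
Proof. induction n as [|n IH]; simpl; [lia|]. destruct Z.eqb; lia. Qed.

Lemma qhatpow_pos n q p : 0 < qhatpow n q p.
Proof.
  unfold qhatpow. induction n as [|n IH]; simpl; [lra|]. apply Rmult_lt_0_compat; auto.
  destruct (Z.eqb_spec (q n) 0); [lra|]. apply pow_lt, Rabs_pos_lt, eq_IZR_contrapositive; auto.
Qed.

Lemma rprod_split n q a b p :
  rprod n (fun i => if Z.eqb (q i) 0 then a else b / Rabs (IZR (q i)) ^ p)
  = a ^ (n - qnorm0 n q) * b ^ qnorm0 n q / qhatpow n q p.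
Proof.
  unfold qhatpow. induction n as [|n IH]; [simpl; field|]. cbn [rprod qnorm0]. rewrite IH.
  assert (H := qnorm0_le n q). assert (Hp := qhatpow_pos n q p). unfold qhatpow in Hp.
  destruct (Z.eqb_spec (q n) 0).
  - rewrite Nat.add_0_r. replace (S n - qnorm0 n q)%nat with (S (n - qnorm0 n q)) by lia.
    simpl. field. lra.
  - replace (S n - (qnorm0 n q + 1))%nat with (n - qnorm0 n q)%nat by lia.
    rewrite Nat.add_1_r. simpl. field. split; [|lra].
    apply pow_nonzero, Rabs_no_R0, eq_IZR_contrapositive; auto.
Qed.

Lemma Rabs_IZR_ge_1 z : z <> 0%Z -> 1 <= Rabs (IZR z).
Proof. intros H. rewrite <- abs_IZR. apply IZR_le. lia. Qed.

(** The factor 2 in the last bound pays for the scaling functions, stored at level l0 - 1 but of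
    scale 2 ^ l0. *)
Lemma scale_bounds n l0 L l k i : (2 <= l0)%nat -> (l0 < L)%nat -> in_J n l0 L l k -> (i < n)%nat ->
  2 ^ l0 <= scale l0 (l i) /\ scale l0 (l i) <= 2 ^ L /\ scale l0 (l i) <= 2 * 2 ^ nmax n l.
Proof.
  intros Hl0 HL HJ Hi. destruct (HJ i Hi) as (H1 & H2 & _).
  assert (H3 := nmax_ge n l i Hi). unfold scale.
  change (2 * 2 ^ nmax n l) with (2 ^ S (nmax n l)).
  destruct (Nat.eqb_spec (l i) (l0 - 1)); repeat split; apply Rle_pow; (lra || lia).
Qed.

Lemma factor_le_quartic D E N y T : 0 <= D -> 0 <= N <= T -> 0 < y ->
  E * y ^ 4 <= D * N ^ 3 -> E <= D * (T ^ 3 / y ^ 4).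
Proof.
  intros HD HN Hy H. assert (Hy4 : 0 < y ^ 4) by (apply pow_lt; auto).
  apply (Rmult_le_reg_r (y ^ 4)); auto.
  replace (D * (T ^ 3 / y ^ 4) * y ^ 4) with (D * T ^ 3) by (field; lra).
  apply Rle_trans with (1 := H). apply Rmult_le_compat_l; auto. apply pow_incr; auto.
Qed.

(** Both branches of min(1/N, N^3/y^4) meet at N = y, where they equal 1/y: the mass bound serves y
    <= N, the quartic one y > N. *)
Lemma factor_le_inv D E N y : 0 <= D -> 0 < N -> 0 < y ->
  E <= D / N -> E * y ^ 4 <= D * N ^ 3 -> E <= D * (1 / y).
Proof.
  intros HD HN Hy H1 H2. destruct (Rle_dec y N) as [H|H].
  - apply Rle_trans with (1 := H1). apply Rmult_le_compat_l; auto.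
    unfold Rdiv; rewrite Rmult_1_l. apply Rinv_le_contravar; auto.
  - replace (1 / y) with (y ^ 3 / y ^ 4) by (field; lra).
    apply factor_le_quartic with N; auto; lra.
Qed.

Lemma inv_sqr_le N M : 0 < N -> N <= 2 * M -> 0 < / M ^ 2 <= 4 / N ^ 2.
Proof.
  intros HN HM. assert (0 < M) by lra. split; [apply Rinv_0_lt_compat, pow_lt; auto|].
  replace (4 / N ^ 2) with (/ (N / 2) ^ 2) by (field; lra).
  apply Rinv_le_contravar; [apply pow_lt; lra|]. apply pow_incr; lra.
Qed.

(** / M ^ 2 must be traded for 4 / N^2 before N is enlarged to T: the combination 4 D N / y^4 is
    increasing in N, while 4 / N^2 alone is not. *)
Lemma factor_scaled_le_quartic D E N y T M : 0 <= D -> 0 < N <= T -> 0 < y -> N <= 2 * M ->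
  0 <= E -> E * y ^ 4 <= D * N ^ 3 -> E * / M ^ 2 <= D * (T ^ 3 / y ^ 4) * (4 / T ^ 2).
Proof.
  intros HD HN Hy HM HE H. destruct (inv_sqr_le N M) as [H1 H2]; try lra.
  apply Rle_trans with (D * (N ^ 3 / y ^ 4) * (4 / N ^ 2)).
  - apply Rmult_le_compat; try lra. apply factor_le_quartic with N; lra.
  - assert (Hy4 : 0 < y ^ 4) by (apply pow_lt; auto).
    replace (D * (N ^ 3 / y ^ 4) * (4 / N ^ 2)) with (4 * D / y ^ 4 * N) by (field; lra).
    replace (D * (T ^ 3 / y ^ 4) * (4 / T ^ 2)) with (4 * D / y ^ 4 * T) by (field; lra).
    apply Rmult_le_compat_l; [|lra]. apply Rmult_le_pos; [lra|].
    apply Rlt_le, Rinv_0_lt_compat; auto.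
Qed.

(** For y <= N, 1/N^3 is at most 1/y^3; for N < y the scaled quartic bound with T = y gives the same
    value. *)
Lemma factor_scaled_le_inv D E N y M : 0 <= D -> 0 < N -> 0 < y -> N <= 2 * M ->
  0 <= E <= D / N -> E * y ^ 4 <= D * N ^ 3 -> E * / M ^ 2 <= D * (1 / y) * (4 / y ^ 2).
Proof.
  intros HD HN Hy HM HE H. destruct (Rle_dec y N) as [Hc|Hc].
  - destruct (inv_sqr_le N M) as [H1 H2]; try lra.
    assert (/ N <= / y) by (apply Rinv_le_contravar; auto).
    assert (0 < / N) by (apply Rinv_0_lt_compat; auto).
    apply Rmult_le_compat; try lra.
    + apply Rle_trans with (D / N); [lra|]. apply Rmult_le_compat_l; lra.
    + apply Rle_trans with (1 := H2). unfold Rdiv. rewrite <- !pow_inv.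
      apply Rmult_le_compat_l; [lra|]. apply pow_incr; lra.
  - replace (D * (1 / y) * (4 / y ^ 2)) with (D * (y ^ 3 / y ^ 4) * (4 / y ^ 2)) by (field; lra).
    apply factor_scaled_le_quartic with N; lra.
Qed.

(** * Bounds on the supremum *)

Lemma mu_le n l0 L eta rho beta q B :
  (forall l k, in_J n l0 L l k ->
     Cmod (aform n eta rho beta (wavhat n l0 l k) (xihat n q)) ^ 2 <= B) ->
  Rbar_le (mu n l0 L eta rho beta q) (Finite B).
Proof.
  intros H. unfold mu. apply (proj2 (Lub_Rbar_correct _)).
  intros r (l & k & HJ & ->). simpl. apply H; auto.
Qed.

Lemma pow4_sqr m : 4 ^ m = (2 ^ m) ^ 2.
Proof. rewrite <- pow_mult, Nat.mul_comm, pow_mult. f_equal; ring. Qed.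

Lemma mu_zero_le n l0 L eta rho beta : (1 < n)%nat -> (2 <= l0)%nat -> (l0 < L)%nat ->
  Rbar_le (mu n l0 L eta rho beta (fun _ => 0%Z))
    (Finite (4 * 2592 ^ n * (Rabs rho ^ 2 / 2 ^ ((2 + n) * l0)))).
Proof.
  intros Hn Hl0 HL. apply mu_le; intros l k HJ.
  destruct (aform_wavhat n l0 L l k eta rho beta (fun _ => 0%Z) Hl0 HJ) as (E & HE & ->).
  rewrite symbol_sqr_zero.
  assert (H2 : 0 < 2 ^ l0) by (apply pow_lt; lra).
  replace (4 * 2592 ^ n * (Rabs rho ^ 2 / 2 ^ ((2 + n) * l0)))
    with (Rabs rho ^ 2 * ((2592 / 2 ^ l0) ^ n * (4 / (2 ^ l0) ^ 2))).
  - apply Rmult_le_compat_l; [apply pow2_ge_0|]. rewrite pow4_sqr.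
    (* Any coordinate would do: it only serves to show 2 ^ l0 <= 2 * 2 ^ nmax n l, so that the
       normalisation yields the extra 2^(-2 l0). *)
    destruct (scale_bounds n l0 L l k 0 Hl0 HL HJ ltac:(lia)) as (S1 & _ & S3).
    destruct (inv_sqr_le (2 ^ l0) (2 ^ nmax n l)) as [I1 I2]; try lra.
    apply Rmult_le_compat; try lra.
    + apply rprod_nonneg; intros; apply HE; auto.
    + rewrite <- rprod_const. apply rprod_le; intros i Hi.
      destruct (HE i Hi) as [[H0 H1] _]. split; auto.
      destruct (scale_bounds n l0 L l k i Hl0 HL HJ Hi) as (S1' & _).
      apply Rle_trans with (1 := H1). apply Rmult_le_compat_l; [lra|].
      apply Rinv_le_contravar; auto.
  - unfold Rdiv. rewrite Rpow_mult_distr, pow_inv, <- pow_mult.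
    rewrite Nat.mul_add_distr_r, pow_add, (Nat.mul_comm n l0), (Nat.mul_comm 2 l0), !pow_mult.
    assert (0 < (2 ^ l0) ^ n) by (apply pow_lt; auto). field. split; lra.
Qed.

Lemma qinf_pos n q : (exists i, (i < n)%nat /\ q i <> 0%Z) -> 0 < qinf n q.
Proof.
  intros (i & Hi & Hq). unfold qinf.
  generalize (rmax_ge n (fun i => Rabs (IZR (q i))) i Hi) (Rabs_IZR_ge_1 _ Hq); simpl; lra.
Qed.

Lemma qnorm2_pos n q : (exists i, (i < n)%nat /\ q i <> 0%Z) -> 0 < qnorm2 n q.
Proof.
  intros (i & Hi & Hq). unfold qnorm2. apply sqrt_lt_R0.
  assert (H : IZR (q i) ^ 2 <= rsum n (fun i => IZR (q i) ^ 2)).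
  { clear Hq. induction n as [|n IH]; [lia|]. cbn [rsum].
    destruct (Nat.eq_dec i n) as [->|].
    - generalize (rsum_sqr_nonneg n (fun i => IZR (q i))); simpl; lra.
    - specialize (IH ltac:(lia)). generalize (pow2_ge_0 (IZR (q n))); lra. }
  assert (0 < IZR (q i) ^ 2); [|lra].
  rewrite <- pow2_abs. apply pow_lt. generalize (Rabs_IZR_ge_1 _ Hq); lra.
Qed.

(* One nonzero coordinate (the largest one, for the second bound) absorbs the normalisation
   [4 ^ - nmax n l]; the others are estimated separately. *)
Lemma wavelet_prod_le n l0 L l k q E : (2 <= l0)%nat -> (l0 < L)%nat -> in_J n l0 L l k ->
  (exists i, (i < n)%nat /\ q i <> 0%Z) ->
  (forall i, (i < n)%nat -> 0 <= E i <= 2592 / scale l0 (l i) /\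
     E i * IZR (q i) ^ 4 <= 2592 * scale l0 (l i) ^ 3) ->
  rprod n E * / 4 ^ nmax n l <= 4 * 2592 ^ n * (/ 2 ^ l0) ^ (n - qnorm0 n q) *
    Rmin ((2 ^ L) ^ (3 * qnorm0 n q) / (2 ^ L) ^ 2 / qhatpow n q 4)
         (/ (qinf n q ^ 2 * qhatpow n q 1)).
Proof.
  intros Hl0 HL HJ Hex HE. rewrite pow4_sqr.
  assert (H2 : 0 < 2 ^ l0) by (apply pow_lt; lra).
  assert (HT : 0 < 2 ^ L) by (apply pow_lt; lra).
  assert (HM : 0 < 2 ^ nmax n l) by (apply pow_lt; lra).
  assert (HM2 : 0 <= / (2 ^ nmax n l) ^ 2) by (apply Rlt_le, Rinv_0_lt_compat, pow_lt, HM).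
  (* The bound for coordinates with q_i = 0, where the quartic estimate says nothing; their number
     gives the power of 2^(-l0). *)
  assert (Hz : forall i, (i < n)%nat -> E i <= 2592 * / 2 ^ l0).
  { intros i Hi. destruct (HE i Hi) as [[H0 H1] _].
    destruct (scale_bounds n l0 L l k i Hl0 HL HJ Hi) as (S1 & _).
    apply Rle_trans with (1 := H1). apply Rmult_le_compat_l; [lra|].
    apply Rinv_le_contravar; auto. }
  assert (Hq4 : forall z, IZR z ^ 4 = Rabs (IZR z) ^ 4).
  { intro z. replace 4%nat with (2 * 2)%nat by reflexivity. now rewrite !pow_mult, pow2_abs. }
  apply Rmin_case.
  - destruct Hex as (i0 & Hi0 & Hq0).
    assert (HP := rprod_split n q (/ 2 ^ l0) ((2 ^ L) ^ 3) 4).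
    apply Rle_trans with (rprod n (fun i => 2592 * (if Z.eqb (q i) 0 then / 2 ^ l0
      else (2 ^ L) ^ 3 / Rabs (IZR (q i)) ^ 4)) * (4 / (2 ^ L) ^ 2)).
    + apply rprod_le_at with i0; auto.
      * intros i Hi. split; [apply HE; auto|]. destruct (Z.eqb_spec (q i) 0); auto.
        destruct (HE i Hi) as [_ H3]. destruct (scale_bounds n l0 L l k i Hl0 HL HJ Hi) as (S1 & S2 & _).
        apply factor_le_quartic with (scale l0 (l i)); try lra.
        { generalize (Rabs_IZR_ge_1 (q i)); intuition lra. }
        { rewrite <- Hq4; auto. }
      * destruct (Z.eqb_spec (q i0) 0); [lia|].
        destruct (HE i0 Hi0) as [H1 H3].
        destruct (scale_bounds n l0 L l k i0 Hl0 HL HJ Hi0) as (S1 & S2 & S3).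
        apply factor_scaled_le_quartic with (scale l0 (l i0)); try lra.
        { generalize (Rabs_IZR_ge_1 (q i0)); intuition lra. }
        { rewrite <- Hq4; auto. }
    + rewrite rprod_scal, HP, <- pow_mult. apply Req_le. field.
      split; [lra|]. generalize (qhatpow_pos n q 4); lra.
  - assert (Hinf := qinf_pos n q Hex).
    destruct (rmax_attained n (fun i => Rabs (IZR (q i))) Hinf) as (i0 & Hi0 & Hm).
    fold (qinf n q) in Hm. rewrite Hm in Hinf.
    assert (HP := rprod_split n q (/ 2 ^ l0) 1 1).
    apply Rle_trans with (rprod n (fun i => 2592 * (if Z.eqb (q i) 0 then / 2 ^ l0
      else 1 / Rabs (IZR (q i)) ^ 1)) * (4 / qinf n q ^ 2)).
    + apply rprod_le_at with i0; auto.
      * intros i Hi. split; [apply HE; auto|]. destruct (Z.eqb_spec (q i) 0); auto.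
        destruct (HE i Hi) as [H1 H3]. destruct (scale_bounds n l0 L l k i Hl0 HL HJ Hi) as (S1 & _).
        rewrite pow_1. apply factor_le_inv with (scale l0 (l i)); try lra.
        { generalize (Rabs_IZR_ge_1 (q i)); intuition lra. }
        { rewrite <- Hq4; auto. }
      * destruct (Z.eqb_spec (q i0) 0) as [E0|]; [rewrite E0, Rabs_R0 in Hinf; lra|].
        destruct (HE i0 Hi0) as [H1 H3].
        destruct (scale_bounds n l0 L l k i0 Hl0 HL HJ Hi0) as (S1 & S2 & S3).
        rewrite Hm, pow_1. apply factor_scaled_le_inv with (scale l0 (l i0)); try lra.
        rewrite <- Hq4; auto.
    + rewrite rprod_scal, HP, pow1. apply Req_le. rewrite Hm. field.
      split; [generalize (qhatpow_pos n q 1)|]; lra.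
Qed.

Lemma powerRZ_2_opp k : powerRZ 2 (- Z.of_nat k) = / 2 ^ k.
Proof. now rewrite powerRZ_neg', <- pow_powerRZ. Qed.

(** The quotient form avoids the subtraction in the exponent, which is negative for m = 0. *)
Lemma powerRZ_2_level m L :
  powerRZ 2 ((3 * Z.of_nat m - 2) * Z.of_nat L) = (2 ^ L) ^ (3 * m) / (2 ^ L) ^ 2.
Proof.
  replace ((3 * Z.of_nat m - 2) * Z.of_nat L)%Z
    with (Z.of_nat (L * (3 * m)) + - Z.of_nat (L * 2))%Z by lia.
  rewrite powerRZ_add by lra. rewrite powerRZ_2_opp, <- pow_powerRZ, !pow_mult. reflexivity.
Qed.

Lemma Rmin_scal a x y : 0 <= a -> a * Rmin x y = Rmin (a * x) (a * y).
Proof.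
  intros Ha. unfold Rmin. destruct (Rle_dec x y), (Rle_dec (a * x) (a * y)); nra.
Qed.

Lemma mu_nonzero_le n l0 L eta rho beta q : (2 <= l0)%nat -> (l0 < L)%nat ->
  (exists i, (i < n)%nat /\ q i <> 0%Z) ->
  Rbar_le (mu n l0 L eta rho beta q)
    (Finite (512 * 2592 ^ n *
      ((Rabs eta ^ 2 + vnorm2 n beta ^ 2 / qnorm2 n q ^ 2 + Rabs rho ^ 2 / qnorm2 n q ^ 4)
       * powerRZ 2 (- Z.of_nat ((n - qnorm0 n q) * l0))
       * Rmin (powerRZ 2 ((3 * Z.of_nat (qnorm0 n q) - 2) * Z.of_nat L)
                 * qnorm2 n q ^ 2 / qhatpow n q 4)
              (qnorm2 n q ^ 2 / (qinf n q ^ 2 * qhatpow n q 1))))).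
Proof.
  intros Hl0 HL Hex. apply mu_le; intros l k HJ.
  destruct (aform_wavhat n l0 L l k eta rho beta q Hl0 HJ) as (E & HE & ->).
  assert (HQ := qnorm2_pos n q Hex).
  assert (HS := symbol_sqr_le n eta rho beta q HQ).
  assert (HP := wavelet_prod_le n l0 L l k q E Hl0 HL HJ Hex HE).
  rewrite powerRZ_2_opp, powerRZ_2_level, Nat.mul_comm, pow_mult, <- (pow_inv (2 ^ l0)).
  set (th := Rabs eta ^ 2 + _ + _) in *.
  set (p := (/ 2 ^ l0) ^ (n - qnorm0 n q)) in *.
  set (x := (2 ^ L) ^ (3 * qnorm0 n q) / (2 ^ L) ^ 2) in *.
  replace (x * qnorm2 n q ^ 2 / qhatpow n q 4) with (qnorm2 n q ^ 2 * (x / qhatpow n q 4))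
    by (unfold Rdiv; ring).
  unfold Rdiv at 2. rewrite <- Rmin_scal by apply pow2_ge_0.
  set (r := Rmin _ _) in *.
  (* 512 is 128 from the symbol times 4 from the normalisation. *)
  replace (512 * 2592 ^ n * (th * p * (qnorm2 n q ^ 2 * r)))
    with (128 * qnorm2 n q ^ 2 * th * (4 * 2592 ^ n * p * r)) by ring.
  apply Rmult_le_compat; auto.
  - unfold symbol_sqr. apply Rmult_le_pos.
    + apply Rlt_le, Rinv_0_lt_compat. generalize (pow2_ge_0 (2 * PI * qnorm2 n q)); lra.
    + apply Rplus_le_le_0_compat; apply pow2_ge_0.
  - apply Rmult_le_pos.
    + apply rprod_nonneg; intros; apply HE; auto.
    + apply Rlt_le, Rinv_0_lt_compat, pow_lt; lra.
Qed.

Theorem theorem4p7 :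
  exists c : R, 0 < c /\
  forall (n l0 L : nat) (eta rho : R) (beta : vec),
    (1 < n)%nat -> (2 <= l0)%nat -> (l0 < L)%nat ->
    Rbar_le (mu n l0 L eta rho beta (fun _ => 0%Z))
            (Finite (c ^ n * (Rabs rho ^ 2 / 2 ^ ((2 + n) * l0)))) /\
    forall q : nat -> Z, (exists i, (i < n)%nat /\ q i <> 0%Z) ->
    Rbar_le (mu n l0 L eta rho beta q)
      (Finite (c ^ n *
        ((Rabs eta ^ 2 + vnorm2 n beta ^ 2 / qnorm2 n q ^ 2
          + Rabs rho ^ 2 / qnorm2 n q ^ 4)
         * powerRZ 2 (- Z.of_nat ((n - qnorm0 n q) * l0))
         * Rmin (powerRZ 2 ((3 * Z.of_nat (qnorm0 n q) - 2) * Z.of_nat L)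
                   * qnorm2 n q ^ 2 / qhatpow n q 4)
                (qnorm2 n q ^ 2 / (qinf n q ^ 2 * qhatpow n q 1))))).
Proof.
  (* 2592 is paid once per coordinate; the single factor 512 is absorbed into 512 ^ n because n >=
     1. *)
  exists (512 * 2592). split; [lra|]. intros n l0 L eta rho beta Hn Hl0 HL.
  assert (Hc : 512 * 2592 ^ n <= (512 * 2592) ^ n).
  { rewrite Rpow_mult_distr. apply Rmult_le_compat_r; [apply pow_le; lra|].
    rewrite <- (pow_1 512) at 1. apply Rle_pow; [lra | lia]. }
  assert (H0 : 0 <= 2592 ^ n) by (apply pow_le; lra).
  split.
  - eapply Rbar_le_trans; [apply mu_zero_le; auto|]. cbn [Rbar_le].
    apply Rmult_le_compat_r; [|lra].
    apply Rmult_le_pos; [apply pow2_ge_0 | apply Rlt_le, Rinv_0_lt_compat, pow_lt; lra].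
  - intros q Hex. eapply Rbar_le_trans; [apply mu_nonzero_le; auto|]. cbn [Rbar_le].
    apply Rmult_le_compat_r; [|exact Hc].
    assert (HQ := qnorm2_pos n q Hex). assert (Hi := qinf_pos n q Hex).
    repeat apply Rmult_le_pos.
    + repeat apply Rplus_le_le_0_compat; try apply pow2_ge_0;
        (apply Rmult_le_pos; [apply pow2_ge_0 | apply Rlt_le, Rinv_0_lt_compat, pow_lt; auto]).
    + apply powerRZ_le; lra.
    + apply Rmin_glb; apply Rmult_le_pos.
      * apply Rmult_le_pos; [apply powerRZ_le; lra | apply pow2_ge_0].
      * apply Rlt_le, Rinv_0_lt_compat, qhatpow_pos.
      * apply pow2_ge_0.
      * apply Rlt_le, Rinv_0_lt_compat, Rmult_lt_0_compat; [apply pow_lt; auto | apply qhatpow_pos].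
Qed.
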